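(* Let $D$ be a linear differential operator of order $k\ge0$, and let $K(\mathbf{x},\mathbf{y})=\Phi(\mathbf{x}-\mathbf{y})$, with $\Phi:\mathbb{R}^d\to\mathbb{R}$, be a translation-invariant symmetric conditionally positive definite kernel of order $s\ge0$ on $\mathbb{R}^d$. Let $\mathbf{z}\in\mathbb{R}^d$ and let $\mathbf{X}=\{\mathbf{x}_1,\ldots,\mathbf{x}_N\}\subset\mathbb{R}^d$ be a finite set of (distinct) points. Assume that there is at least one $w\in\mathbb{R}^N$ with $\sum_{j=1}^N w_jp(\mathbf{x}_j)=Dp(\mathbf{z})$ for all $p\in\Pi^d_s$, and that $\Phi\in C^{r,\gamma}(B_{\mathbf{z},\mathbf{X}})$ for some integer $r\ge2k$ and some $\gamma\in(0,1]$. Let $w^*$ be the weight vector of the kernel-based numerical differentiation formula for $D$, $K$, $s$, $\mathbf{z}$, $\mathbf{X}$. Then for all $f\in\mathcal{F}_K$, $$\Big|Df(\mathbf{z})-\sum_{j=1}^N w_j^*f(\mathbf{x}_j)\Big|\le\rho_{q,D}\big(\mathbf{z},\mathbf{X},\tfrac{r+\gamma}{2}\big)\,C_{d,r}^{1/2}\,|\Phi|_{C^{r,\gamma}(B_{\mathbf{z},\mathbf{X}})}^{1/2}\,\|f\|_K,$$ where $q=\max\{s,\lfloor r/2\rfloor+1\}$ and $$C_{d,r}=\begin{cases}\dfrac{2d^{r/2}}{(\gamma/2+1)^2\cdots(\gamma/2+\lfloor r/2\rfloor)^2}&\text{if } r \text{ is even},\\[2mm]\dfrac{d^{r/2}}{((1+\gamma)/2+1)^2\cdots((1+\gamma)/2+\lfloor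 r/2\rfloor)^2}&\text{if } r\text{ is odd}\end{cases}$$ (an empty product being $1$).
   Context: Notation. $\Pi^d_q$ is the space of $d$-variate real polynomials of total degree at most $q-1$ ($\Pi^d_0=\{0\}$). $S_{\mathbf{z},\mathbf{X}}:=\bigcup_{i=1}^N[\mathbf{z},\mathbf{x}_i]$ is the union of closed line segments, and $B_{\mathbf{z},\mathbf{X}}$ is the closed ball in $\mathbb{R}^d$ centered at the origin with radius equal to the diameter of $S_{\mathbf{z},\mathbf{X}}$. Differential operator: $Df=\sum_{|\alpha|\le k}a_\alpha\partial^\alpha f$ with real variable coefficients $a_\alpha$ (functions). $D'K$ denotes $D$ applied to the first $d$-dimensional argument of $K$. Hölder space. For an integer $r\ge0$ and $0<\gamma\le1$, $C^{r,\gamma}(\Omega)$ consists of all $r$ times continuously differentiable functions $f$ on $\Omega\subset\mathbb{R}^d$ with $|f|_{C^{r,\gamma}(\Omega)}:=\max_{|\alpha|=r}|\partial^\alpha f|_{C^{0,\gamma}(\Omega)}<\infty$, where $|g|_{C^{0,\gamma}(\Omega)}:=\sup_{\mathbf{x},\mathbf{y}\in\Omega,\,\mathbf{x}\ne\mathbf{y}}|g(\mathbf{x})-g(\mathbf{y})|/\|\mathbf{x}-\mathbf{y}\|_2^\gamma$. A symmetric kernel $K$ is conditionally positive definite of order $s$ on $\mathbb{R}^d$ if $\sum_{i,j=1}^n a_ia_jK(\mathbf{y}_i,\mathbf{y}_j)>0$ for all pairwise distinct $\mathbf{y}_1,\ldots,\mathbf{y}_n\in\mathbb{R}^d$ and all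 $a\in\mathbb{R}^n\setminus\{0\}$ with $\sum_ja_jp(\mathbf{y}_j)=0$ for all $p\in\Pi^d_s$ (for $s=0$: strictly positive definite). Kernel-based formula. Let $p_1,\ldots,p_M$ be a basis of $\Pi^d_s$ ($M=\binom{d+s-1}{d}$, and $M=0$ if $s=0$). The weight vector $w^*$ is the $w$-part of a solution $(w,v)\in\mathbb{R}^N\times\mathbb{R}^M$ of $$\sum_{j=1}^N w_jK(\mathbf{x}_i,\mathbf{x}_j)+\sum_{j=1}^M v_jp_j(\mathbf{x}_i)=D'K(\mathbf{z},\mathbf{x}_i)\ (1\le i\le N),\qquad \sum_{j=1}^N w_jp_i(\mathbf{x}_j)=Dp_i(\mathbf{z})\ (1\le i\le M).$$ It is known that if the second group of equations is consistent, then the whole system is solvable and $w^*$ is uniquely determined ($v$ may be non-unique). Native space. $\mathcal{F}_K$ is the semi-Hilbert space of real-valued functions on $\mathbb{R}^d$ obtained as completion of the space of functions $\sum_ia_iK(\cdot,\mathbf{y}_i)+p$ (finite sums, $p\in\Pi^d_s$, $\sum_ia_iq(\mathbf{y}_i)=0$ for all $q\in\Pi^d_s$) with squared semi-norm $\|\sum_ia_iK(\cdot,\mathbf{y}_i)+p\|_K^2=\sum_{i,j}a_ia_jK(\mathbf{y}_i,\mathbf{y}_j)$; polynomials in $\Pi^d_s$ have semi-norm zero. Equivalently, $f:\mathbb{R}^d\to\mathbb{R}$ belongs to $\mathcal{F}_K$ with $\|f\|_K\le C$ iff $|\sum_ia_if(\mathbf{y}_i)|\le C(\sum_{i,j}a_ia_jK(\mathbf{y}_i,\mathbf{y}_j))^{1/2}$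 for all finite sets of points $\mathbf{y}_i$ and coefficients $a_i$ with $\sum_ia_iq(\mathbf{y}_i)=0$ for all $q\in\Pi^d_s$. Growth function. For $\mu\ge0$, $\rho_{q,D}(\mathbf{z},\mathbf{X},\mu):=\sup\{Dp(\mathbf{z}):p\in\Pi^d_q,\ |p(\mathbf{x}_j)|\le\|\mathbf{x}_j-\mathbf{z}\|_2^\mu,\ j=1,\ldots,N\}\in[0,\infty]$; if it equals $\infty$ the bound is void. *)

(* Defs.v *)
From mathcomp Require Import all_boot all_order all_algebra.
From mathcomp Require Import all_classical all_reals all_analysis.
(* The notations of mpoly clash with those of MathComp-Analysis. *)
Require Import -(notations) mathcomp.multinomials.mpoly.

Set Implicit Arguments.
Unset Strict Implicit.
Unset Printing Implicit Defensive.
Import Order.TTheory GRing.Theory Num.Theory numFieldNormedType.Exports.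
Local Open Scope classical_set_scope.
Local Open Scope ring_scope.

Section Defs.
Context {R : realType} {d : nat}.
(* The topology carried by 'rV[R]_d is that of the max norm `|x|; it is the
   usual one, but lengths and distances must be measured with [enorm]. *)
Implicit Types (x y z : 'rV[R]_d) (f g Phi : 'rV[R]_d -> R)
  (K : 'rV[R]_d -> 'rV[R]_d -> R) (A : set 'rV[R]_d) (s q k r : nat)
  (a : multinom d -> 'rV[R]_d -> R) (p : mpoly d R).

Definition enorm x : R := Num.sqrt (\sum_(i < d) x 0 i ^+ 2).

Definition peval p x : R := meval (x 0) p.

(* Total degree at most q - 1; [msize] is 1 + the total degree, and
   msize 0 = 0, so that Pi_poly 0 = {0}. *)
Definition Pi_poly q : set (mpoly d R) := [set p | (mpoly.msize p <= q)%N].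

Definition Pi_basis s M (b : 'I_M -> mpoly d R) : Prop :=
  (forall i, Pi_poly s (b i)) /\
  forall p, Pi_poly s p ->
    exists! c : 'rV[R]_M, p = \sum_(i < M) c 0 i *: b i.

Definition partial (i : 'I_d) f : 'rV[R]_d -> R :=
  fun x => 'D_(delta_mx 0 i : 'rV[R]_d) f x.

(* Iterated partial derivative; the last direction of the list acts first. *)
Definition partials (l : seq 'I_d) f : 'rV[R]_d -> R := foldr partial f l.

Definition mpartial (alpha : multinom d) f : 'rV[R]_d -> R :=
  partials (flatten [seq nseq (alpha i) i | i <- enum 'I_d]) f.

Definition Cr_open r f A : Prop :=
  forall (l : seq 'I_d) x, A x ->
    ((size l <= r)%N -> {for x, continuous (partials l f)}) /\
    ((size l < r)%N -> forall i : 'I_d,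
       derivable (partials l f) x (delta_mx 0 i : 'rV[R]_d)).

(* A need not be open: r times continuously differentiable on A means on an
   open set containing A, so that all derivatives make sense on A. *)
Definition Cr_on r f A : Prop :=
  exists U : set 'rV[R]_d, [/\ open U, A `<=` U & Cr_open r f U].

(* The supremum of the empty set is taken to be 0. *)
Definition holder0_seminorm (gamma : R) A g : \bar R :=
  maxe 0%E (ereal_sup [set t : \bar R | exists x y, [/\ A x, A y, x != y &
    t = (`|g x - g y| / enorm (x - y) `^ gamma)%:E]]).

Definition holder_seminorm r (gamma : R) A f : \bar R :=
  \big[maxe/0%E]_(alpha : bmultinom d r.+1 | mdeg alpha == r)
    holder0_seminorm gamma A (mpartial alpha f).

Definition in_holder r (gamma : R) A f : Prop :=
  Cr_on r f A /\ (holder_seminorm r gamma A f < +oo)%E.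

Definition diffop k a f : 'rV[R]_d -> R :=
  fun x => \sum_(alpha : bmultinom d k.+1) a alpha x * mpartial alpha f x.

Definition segment_union N z (X : 'I_N -> 'rV[R]_d) : set 'rV[R]_d :=
  [set y | exists i (t : R), 0 <= t <= 1 /\ y = (1 - t) *: z + t *: X i].

Definition diameter A : R := sup [set enorm (x - y) | x in A & y in A].

Definition ballzX N z (X : 'I_N -> 'rV[R]_d) : set 'rV[R]_d :=
  [set y | enorm y <= diameter (segment_union z X)].

Definition ti_kernel Phi : 'rV[R]_d -> 'rV[R]_d -> R :=
  fun x y => Phi (x - y).

Definition symmetric_kernel K : Prop := forall x y, K x y = K y x.

Definition cond_posdef s K : Prop :=
  forall n (y : 'I_n -> 'rV[R]_d) (c : 'I_n -> R),
    injective y -> (exists i, c i != 0) ->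
    (forall p, Pi_poly s p -> \sum_(j < n) c j * peval p (y j) = 0) ->
    0 < \sum_(i < n) \sum_(j < n) c i * c j * K (y i) (y j).

Definition exact_weight s k a z N (X : 'I_N -> 'rV[R]_d) (w : 'I_N -> R) :=
  forall p, Pi_poly s p ->
    \sum_(j < N) w j * peval p (X j) = diffop k a (peval p) z.

Definition kernel_weight k a K M (b : 'I_M -> mpoly d R) z N
    (X : 'I_N -> 'rV[R]_d) (w : 'I_N -> R) : Prop :=
  exists v : 'I_M -> R,
    (forall i, \sum_(j < N) w j * K (X i) (X j)
               + \sum_(j < M) v j * peval (b j) (X i)
             = diffop k a (fun u => K u (X i)) z) /\
    (forall i, \sum_(j < N) w j * peval (b i) (X j)
             = diffop k a (peval (b i)) z).

(* A list of pairs (c_i, y_i) encodes the functional sum_i c_i delta_{y_i}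
   and the kernel sum sum_i c_i K(., y_i). *)
Definition annihilates s (l : seq (R * 'rV[R]_d)) : Prop :=
  forall p, Pi_poly s p -> \sum_(t <- l) t.1 * peval p t.2 = 0.

Definition kernel_sum K (l : seq (R * 'rV[R]_d)) p : 'rV[R]_d -> R :=
  fun x => \sum_(t <- l) t.1 * K x t.2 + peval p x.

Definition sum_norm K (l : seq (R * 'rV[R]_d)) : R :=
  Num.sqrt (\sum_(t <- l) \sum_(u <- l) t.1 * u.1 * K t.2 u.2).

Definition sum_diff (l1 l2 : seq (R * 'rV[R]_d)) : seq (R * 'rV[R]_d) :=
  l1 ++ [seq (- t.1, t.2) | t <- l2].

(* The completion, realized as a space of functions: f is the pointwise limit
   of a sequence of kernel sums plus polynomials of Pi_poly s that is Cauchy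
   for the semi-norm, and c is the limit of their semi-norms. Since the
   polynomials are part of the approximants, every Cauchy sequence can be
   made pointwise convergent by adding elements of the null space. *)
Definition is_native_norm K s f (c : R) : Prop :=
  exists (l : nat -> seq (R * 'rV[R]_d)) (p : nat -> mpoly d R),
    [/\ forall n, annihilates s (l n) /\ Pi_poly s (p n),
        forall eps : R, 0 < eps -> exists n0, forall m n,
          (n0 <= m)%N -> (n0 <= n)%N -> sum_norm K (sum_diff (l m) (l n)) < eps,
        forall x, kernel_sum K (l n) (p n) x @[n --> \oo] --> f x &
        sum_norm K (l n) @[n --> \oo] --> c].

Definition native_space K s : set ('rV[R]_d -> R) :=
  [set f | exists c, is_native_norm K s f c].

Definition native_norm K s f : R := get [set c | is_native_norm K s f c].

Definition growth q k a z N (X : 'I_N -> 'rV[R]_d) (mu : R) : \bar R :=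
  ereal_sup [set (diffop k a (peval p) z)%:E | p in
    [set p | Pi_poly q p /\
             forall j, `|peval p (X j)| <= enorm (X j - z) `^ mu]].

End Defs.

Definition C_const {R : realType} (d r : nat) (gamma : R) : R :=
  if odd r
  then d%:R `^ (r%:R / 2) /
         \prod_(1 <= j < r./2.+1) ((1 + gamma) / 2 + j%:R) ^+ 2
  else 2 * d%:R `^ (r%:R / 2) /
         \prod_(1 <= j < r./2.+1) (gamma / 2 + j%:R) ^+ 2.

(* Main.v *)
(* The error functional e = D_z - sum_j w*_j delta_{x_j} of the kernel formula
   acts on the native space with squared norm e^x e^y K(x, y), and among all
   weights exact on Pi_s the weights w* minimize this quadratic form, because
   K e vanishes at the nodes up to a polynomial of Pi_s. Finiteness of the
   growth function yields, by finite-dimensional duality, weights w exact on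
   Pi_q with sum_j |w_j| |x_j - z|^mu <= rho, where mu = (r + gamma) / 2. For
   these weights the functional is -sum_j w_j R_j, with R_j the Taylor remainder
   at x_j of order m = floor(r / 2), and R_i R_j Phi(x - y) is controlled by a
   mixed second difference of derivatives of order 2m of Phi, hence, taking the
   geometric mean of the two Hoelder estimates of this difference, by
   C_{d,r} |Phi| |x_i - z|^mu |x_j - z|^mu.

   Phi is only known to be smooth near differences of the relevant points, so
   the smoothness of f near z does not come from its approximants: difference
   quotients of f are Cauchy because the native-space bound reduces them to
   mixed difference quotients of the kernel. Polynomials are removed by
   interpolation at finitely many points, which turns the conditional bound
   into an unconditional one for a corrected kernel. *)
Require Import Defs.
From mathcomp Require Import all_boot all_order all_algebra.
From mathcomp Require Import all_classical all_reals all_analysis.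
Require Import -(notations) mathcomp.multinomials.mpoly.
From mathcomp Require Import ring lra.

Set Implicit Arguments.
Unset Strict Implicit.
Unset Printing Implicit Defensive.
Import Order.TTheory GRing.Theory Num.Theory numFieldNormedType.Exports.
Local Open Scope classical_set_scope.
Local Open Scope ring_scope.

(** * Mixed differences and partial derivatives *)

Section Calc.
Context {R : realType}.

(** The native-space inequality is available only for point values, whereas the error functional
    contains derivatives at [z]. It is extended to derivative evaluations by induction on the order;
    each new derivative of [f] differentiates the kernel once in each argument, hence [2 * k <= r].
    The estimates then form a chain of squares: the squared error is at most [c ^+ 2] times the form
    at the kernel weights, then at the weights from duality, then
    [C_const d r gamma * H * rho ^+ 2]. Partial derivatives are indexed by lists of coordinates, so
    that one more derivative is a [cons]; the price is Schwarz's theorem for all permutations of a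
    list. Origin of the constant: each of the [r] directions costs [sqrt d] when its l1 norm is
    compared with the Euclidean one; each Taylor expansion integrates a power [m] times, which gives
    the product of the [beta + j], squared for two arguments. Here [beta] is the excess of [mu] over
    [m]: [gamma / 2] for even [r], [(1 + gamma) / 2] for odd [r]. The factor 2 for even [r] comes
    from splitting a second difference into two Hoelder increments. *)

Lemma MVT_centered (g dg : R -> R) (u : R) :
  (forall t : R, `|t| <= `|u| -> is_derive t 1 g (dg t)) ->
  exists2 t, `|t| <= `|u| & g u - g 0 = dg t * u.
Proof.
move=> gd.
have gc (t : R) : `|t| <= `|u| -> {for t, continuous g}.
  move=> tu; apply/differentiable_continuous/derivable1_diffP.
  by have [] := gd t tu.
case: (leP 0 u) => u0.
- have itvu t : t \in `[0, u] -> `|t| <= `|u|.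
    by rewrite in_itv/= => /andP[t0 tu]; rewrite !ger0_norm.
  have [||c cu ->] := @MVT_segment _ g dg 0 u u0.
  + by move=> x xu; apply: gd; apply: itvu; exact: subset_itv_oo_cc xu.
  + by apply: continuous_in_subspaceT => x; rewrite inE/= => /itvu /gc.
  + by exists c; [exact: itvu | rewrite subr0].
- have itvu t : t \in `[u, 0] -> `|t| <= `|u|.
    by rewrite in_itv/= => /andP[ut t0]; rewrite !ler0_norm ?lerN2// ltW.
  have [||c cu gE] := @MVT_segment _ g dg u 0 (ltW u0).
  + by move=> x xu; apply: gd; apply: itvu; exact: subset_itv_oo_cc xu.
  + by apply: continuous_in_subspaceT => x; rewrite inE/= => /itvu /gc.
  + exists c; first exact: itvu.
    by rewrite -opprB gE sub0r mulrN opprK.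
Qed.

Context {V : normedModType R}.
Implicit Types (f : V -> R) (p v w : V).

Lemma is_derive_line f p v (t : R) : derivable f (p + t *: v) v ->
  is_derive t 1 (fun t => f (p + t *: v)) ('D_v f (p + t *: v)).
Proof.
move=> df.
have E : (fun h : R => h^-1 *: (((fun t => f (p + t *: v)) \o shift t) (h *: (1:R)) - f (p + t *: v)))
  = (fun h : R => h^-1 *: ((f \o shift (p + t *: v)) (h *: v) - f (p + t *: v))).
  apply/funext => h /=; congr (_ *: (f _ - _)).
  by rewrite scalerDl [h *: 1]mulr1 addrCA.
split; first by rewrite /derivable E.
by rewrite /derive E.
Qed.

Lemma MVT_line f p v (u : R) :
  (forall t, `|t| <= `|u| -> derivable f (p + t *: v) v) ->
  exists2 t, `|t| <= `|u| & f (p + u *: v) - f p = 'D_v f (p + t *: v) * u.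
Proof.
move=> df; have [t tu E] := @MVT_centered (fun t => f (p + t *: v))
  (fun t => 'D_v f (p + t *: v)) u (fun t tu => is_derive_line (df t tu)).
by exists t => //; rewrite -E scale0r addr0.
Qed.

(** The mean value theorem is applied twice: along [v] to the difference of two parallel lines
    shifted by [b *: w], whose derivative is an increment of ['D_v f] along [w], and then to that
    increment. *)
Lemma MVT_mixed f p v w (a b : R) :
  (forall s t, `|s| <= `|a| -> `|t| <= `|b| ->
     derivable f (p + s *: v + t *: w) v /\
     derivable ('D_v f) (p + s *: v + t *: w) w) ->
  exists s t, [/\ `|s| <= `|a|, `|t| <= `|b| &
    f (p + a *: v + b *: w) - f (p + a *: v) - f (p + b *: w) + f p
    = 'D_w ('D_v f) (p + s *: v + t *: w) * (a * b)].
Proof.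
move=> df.
have E0 s t : p + t *: w + s *: v = p + s *: v + t *: w by rewrite addrAC.
have dfs (s : R) : `|s| <= `|a| ->
    is_derive s 1 (fun s => f (p + b *: w + s *: v) - f (p + s *: v))
      ('D_v f (p + b *: w + s *: v) - 'D_v f (p + s *: v)).
  move=> sa; apply: is_deriveB.
    by apply: is_derive_line; rewrite E0; exact: (df s b sa (lexx _)).1.
  apply: is_derive_line; have [|+ _] := df s 0 sa; first by rewrite normr0.
  by rewrite scale0r addr0.
have [s /= sa Es] := @MVT_centered
  (fun s => f (p + b *: w + s *: v) - f (p + s *: v))
  (fun s => 'D_v f (p + b *: w + s *: v) - 'D_v f (p + s *: v)) a dfs.
have [t tb Et] := @MVT_line ('D_v f) (p + s *: v) w b
  (fun t tb => (df s t sa tb).2).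
exists s, t; split => //.
move: Es; rewrite E0 [in X in _ = X -> _]E0 Et !scale0r !addr0 => Es.
transitivity ('D_w ('D_v f) (p + s *: v + t *: w) * b * a); last by ring.
by rewrite -Es; ring.
Qed.


Lemma near_box p v w (P : V -> Prop) : (\forall x \near p, P x) ->
  exists2 e : R, 0 < e & forall s t : R, `|s| <= e -> `|t| <= e ->
    P (p + s *: v + t *: w).
Proof.
move=> /nbhs_ballP[d /= d0 dP]; pose M := `|v| + `|w| + 1.
have M0 : 0 < M by rewrite ltr_wpDl// addr_ge0.
exists (d / 2 / M) => [|s t sd td]; first by rewrite !divr_gt0.
apply: dP; rewrite -ball_normE /=.
rewrite -addrA opprD addNKr normrN (le_lt_trans (ler_normD _ _))// !normrZ.
have sv : `|s| * `|v| <= d / 2 / M * `|v| by rewrite ler_wpM2r.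
have tw : `|t| * `|w| <= d / 2 / M * `|w| by rewrite ler_wpM2r.
rewrite (le_lt_trans (lerD sv tw))// -mulrDr mulrAC ltr_pdivrMr//.
have : `|v| + `|w| < M by rewrite /M ltrDl.
have : 0 <= `|v| + `|w| by rewrite addr_ge0.
by move: (`|v| + `|w|) => y; nra.
Qed.

(* Uniformity in both increments is what makes second difference quotients of
   a kernel converge when the two steps are independent. *)
Lemma mixed_difference f p v w :
  (\forall x \near p, derivable f x v) ->
  (\forall x \near p, derivable ('D_v f) x w) ->
  {for p, continuous ('D_w ('D_v f))} ->
  forall e : R, 0 < e -> exists2 d : R, 0 < d &
  forall a b : R, `|a| <= d -> `|b| <= d ->
    `|f (p + a *: v + b *: w) - f (p + a *: v) - f (p + b *: w) + f p
      - 'D_w ('D_v f) p * (a * b)| <= e * `|a * b|.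
Proof.
move=> df ddf cf e e0.
have ne : \forall x \near p, `|'D_w ('D_v f) x - 'D_w ('D_v f) p| <= e.
  by move/cvgrPdistC_le : cf => /(_ e e0).
have [d d0 dP] := near_box v w (filterI ne (filterI df ddf)).
exists d => // a b ad bd.
have [|s [t [sa tb ->]]] := @MVT_mixed f p v w a b.
  by move=> s t sa tb; have [] := dP s t (le_trans sa ad) (le_trans tb bd).
rewrite -mulrBl normrM ler_wpM2r//.
by have [] := dP s t (le_trans sa ad) (le_trans tb bd).
Qed.

(** The second difference is symmetric in [v] and [w]; divided by [h * h] it is close to both
    iterated derivatives, one for each order of application. *)
Lemma derive_comm f p v w :
  (\forall x \near p, derivable f x v) ->
  (\forall x \near p, derivable f x w) ->
  (\forall x \near p, derivable ('D_v f) x w) ->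
  (\forall x \near p, derivable ('D_w f) x v) ->
  {for p, continuous ('D_w ('D_v f))} ->
  {for p, continuous ('D_v ('D_w f))} ->
  'D_w ('D_v f) p = 'D_v ('D_w f) p.
Proof.
move=> fv fw fvw fwv cvw cwv; apply/eqP; rewrite -subr_eq0 -normr_le0.
apply/ler_addgt0Pr => e e0; rewrite add0r.
have e20 : 0 < e / 2 by rewrite divr_gt0.
have [d d0 dP] := mixed_difference fv fvw cvw e20.
have [d' d'0 dP'] := mixed_difference fw fwv cwv e20.
pose h := Num.min d d'; have h0 : 0 < h by rewrite lt_min d0.
have hh0 : 0 < h * h by rewrite mulr_gt0.
have := dP h h; rewrite gtr0_norm// ge_min lexx => /(_ isT isT).
have := dP' h h; rewrite gtr0_norm// ge_min lexx orbT => /(_ isT isT).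
rewrite (gtr0_norm hh0) (addrAC p (h *: w) (h *: v)) => H1 H2.
move: H1 H2; set X := 'D_w _ _; set Y := 'D_v _ _.
move: X Y hh0; move: (h * h) (f _) (f _) (f _) (f p) => hh z1 z2 z3 z4 X Y hh0.
rewrite !ler_norml => /andP[H1 H2] /andP[H3 H4].
by apply/andP; split; rewrite -(ler_pM2r hh0); lra.
Qed.

(* A partial derivative that exists near p and is continuous at p may be added
   to any directional derivative. *)
Lemma is_derive_addv f p a A e (c : R) : is_derive p a f A ->
  (\forall x \near p, derivable f x e) -> {for p, continuous ('D_e f)} ->
  is_derive p (a + c *: e) f (A + c * 'D_e f p).
Proof.
move=> dA de ce.
suff L : (fun h : R => h^-1 *: ((f \o shift p) (h *: (a + c *: e)) - f p))
    @ 0^' --> A + c * 'D_e f p.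
  split; first by apply/cvg_ex; eexists; exact: L.
  by apply: cvg_lim.
have LA : (fun h : R => h^-1 *: ((f \o shift p) (h *: a) - f p)) @ 0^' --> A.
  by case: dA => dA <-.
have -> : (fun h : R => h^-1 *: ((f \o shift p) (h *: (a + c *: e)) - f p)) =
  (fun h : R => h^-1 *: ((f \o shift p) (h *: a) - f p) +
   h^-1 * (f (p + h *: a + (h * c) *: e) - f (p + h *: a))).
  apply/funext => h /=; rewrite -[_ *: (f _ - f p)]/(_ * _) -mulrDr.
  rewrite [h *: a + p]addrC scalerDr scalerA [_ + p]addrC addrA.
  by ring.
apply: cvgD => //; apply/cvgrPdistC_le => eps eps0.
pose eps' := eps / (`|c| + 1).
have c10 : 0 < `|c| + 1 by rewrite ltr_wpDl.
have eps'0 : 0 < eps' by rewrite divr_gt0.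
have ne : \forall x \near p, `|'D_e f x - 'D_e f p| <= eps'.
  by move/cvgrPdistC_le : ce => /(_ _ eps'0).
have [d d0 dP] := near_box a e (filterI ne de).
have dc0 : 0 < d / (`|c| + 1) by rewrite divr_gt0.
near=> h.
have h0 : h != 0 by near: h; exact: nbhs_dnbhs_neq.
have hd : `|h| <= d.
  by near: h; apply: dnbhs0_le.
have hcd : `|h * c| <= d.
  rewrite normrM (@le_trans _ _ (d / (`|c| + 1) * (`|c| + 1)))//; last first.
    by rewrite divfK// gt_eqF.
  by rewrite ler_pM// ?lerDl//; near: h; apply: dnbhs0_le.
have [t th ->] := @MVT_line f (p + h *: a) e (h * c)
   (fun t th => (dP h t hd (le_trans th hcd)).2).
rewrite mulrCA !mulrA mulfVK//.
have [+ _] := dP h t hd (le_trans th hcd).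
set X := 'D_e f _; set Y := 'D_e f p => XY.
rewrite [X * c]mulrC -mulrBr normrM (@le_trans _ _ (`|c| * eps'))// ?ler_wpM2l//.
by rewrite /eps' mulrCA ler_piMr ?(ltW eps0)// ler_pdivrMr// mul1r lerDl.
Unshelve. all: by end_near. Qed.

End Calc.

Lemma cvg_big_sum {R : realType} {T : Type} {I : eqType} (F : set_system T)
    {FF : Filter F} (s : seq I) (f : I -> T -> R) (l : I -> R) :
  (forall i, i \in s -> f i t @[t --> F] --> l i) ->
  \sum_(i <- s) f i t @[t --> F] --> \sum_(i <- s) l i.
Proof.
elim: s => [|i s IH] fl.
  by under eq_fun do rewrite big_nil; rewrite big_nil; exact: cvg_cst.
under eq_fun do rewrite big_cons; rewrite big_cons; apply: cvgD.
  by apply: fl; rewrite mem_head.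
by apply: IH => j js; apply: fl; rewrite inE js orbT.
Qed.

Section Partials.
Context {R : realType} {d : nat}.
Implicit Types (x y c : 'rV[R]_d) (f g : 'rV[R]_d -> R) (U : set 'rV[R]_d)
  (l : seq 'I_d) (r : nat) (p : mpoly d R).

Lemma rV_sum_delta x : x = \sum_(i < d) x 0 i *: delta_mx 0 i.
Proof.
apply/matrixP => a b; rewrite !ord1 summxE (bigD1 b)//= !mxE !eqxx/= mulr1.
by rewrite big1 ?addr0// => i ib; rewrite !mxE/= eq_sym (negbTE ib) mulr0.
Qed.

Lemma eq_partial U f g i x : open U -> (forall y, U y -> f y = g y) -> U x ->
  partial i f x = partial i g x.
Proof.
move=> oU fg Ux; apply: near_eq_derive.
by near=> y; apply: fg; near: y; exact: open_nbhs_nbhs.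
Unshelve. all: by end_near. Qed.

(** A chain rule for translations and reflections without differentiability: equal increments have
    equal difference quotients, and the limits agree even where they take a default value. *)
Lemma eq_derive_quotient f g x y (v w : 'rV[R]_d) :
  (forall h : R, f (h *: v + x) - f x = g (h *: w + y) - g y) ->
  'D_v f x = 'D_w g y.
Proof.
move=> fg; rewrite /derive; apply: (congr1 (fun G : R -> R => lim (G @ 0^'))).
by apply/funext => h /=; rewrite fg.
Qed.

Lemma is_derive_quotient f g x y (v w : 'rV[R]_d) D :
  (forall h : R, f (h *: v + x) - f x = g (h *: w + y) - g y) ->
  is_derive y w g D -> is_derive x v f D.
Proof.
move=> fg [dg <-]; split; last exact: eq_derive_quotient.
suff E : (fun h : R => h^-1 *: ((f \o shift x) (h *: v) - f x)) =
    (fun h : R => h^-1 *: ((g \o shift y) (h *: w) - g y)) by rewrite /derivable E.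
by apply/funext => h /=; rewrite fg.
Qed.

Lemma Cr_openS r U V f : V `<=` U -> Cr_open r f U -> Cr_open r f V.
Proof. by move=> VU Cf l x Vx; exact: Cf (VU _ Vx). Qed.

Section Regular.
Variables (r : nat) (U : set 'rV[R]_d) (f : 'rV[R]_d -> R).
Hypotheses (oU : open U) (Cf : Cr_open r f U).

Lemma near_open x (P : 'rV[R]_d -> Prop) : U x ->
  (forall y, U y -> P y) -> \forall y \near x, P y.
Proof.
move=> Ux UP; near=> y; apply: UP; near: y; exact: open_nbhs_nbhs.
Unshelve. all: by end_near. Qed.

Lemma partials_continuous l x : U x -> (size l <= r)%N ->
  {for x, continuous (partials l f)}.
Proof. by move=> Ux lr; have [+ _] := Cf l Ux; apply. Qed.

Lemma partials_derivable l x i : U x -> (size l < r)%N ->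
  derivable (partials l f) x (delta_mx 0 i : 'rV[R]_d).
Proof. by move=> Ux lr; have [_] := Cf l Ux; apply. Qed.

Lemma partials_swap i j l x : ((size l).+2 <= r)%N -> U x ->
  partials [:: i, j & l] f x = partials [:: j, i & l] f x.
Proof.
move=> lr Ux; apply: (@derive_comm _ _ (partials l f)).
- by apply: near_open Ux _ => y Uy; apply: partials_derivable => //; exact: ltnW.
- by apply: near_open Ux _ => y Uy; apply: partials_derivable => //; exact: ltnW.
- by apply: near_open Ux _ => y Uy; exact: (@partials_derivable (j :: l)).
- by apply: near_open Ux _ => y Uy; exact: (@partials_derivable (i :: l)).
- exact: (@partials_continuous [:: i, j & l]).
- exact: (@partials_continuous [:: j, i & l]).
Qed.

(** Sorting by insertion: [cons_cat] carries the head of [l] by adjacent swaps to its place in [l'].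
    Equality is kept on all of the open set [U], because it is differentiated again at the next
    step. *)
Lemma partials_perm l l' x : perm_eq l l' -> (size l <= r)%N -> U x ->
  partials l f x = partials l' f x.
Proof.
have cons_cat i l1 l2 : (size (i :: l1 ++ l2) <= r)%N -> forall y, U y ->
    partials (i :: l1 ++ l2) f y = partials (l1 ++ i :: l2) f y.
  elim: l1 => [|j l1 IH]//= lr y Uy.
  rewrite -[LHS]/(partials [:: i, j & l1 ++ l2] f y) partials_swap//.
  by apply: (eq_partial j oU _ Uy) => u Uu; apply: IH => //; exact: ltnW.
elim: l l' x => [|i l IH] l' x; first by rewrite perm_sym => /perm_nilP ->.
move=> pl lr Ux; have il' : i \in l' by rewrite -(perm_mem pl) inE eqxx.
have l'E : l' = take (index i l') l' ++ i :: drop (index i l').+1 l'.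
  by rewrite -{1}(cat_take_drop (index i l') l') (drop_nth i) ?index_mem// nth_index.
rewrite {1}l'E in pl; rewrite l'E.
have {}pl : perm_eq l (take (index i l') l' ++ drop (index i l').+1 l').
  rewrite -(perm_cons i) (perm_trans pl)// -[i :: drop _ _]cat1s.
  by rewrite perm_catCA.
rewrite -cons_cat//; last by rewrite /= -(perm_size pl).
by apply: (eq_partial i oU _ Ux) => u Uu; apply: IH => //; exact: ltnW.
Qed.

(** Continuity of the partial derivatives allows the coordinates of [h] to be added to the direction
    one at a time. *)
Lemma is_derive_partials l x h : (size l < r)%N -> U x ->
  is_derive x h (partials l f) (\sum_(i < d) h 0 i * partials (i :: l) f x).
Proof.
move=> lr Ux; rewrite {1}[h]rV_sum_delta.
have : forall s : seq 'I_d,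
    is_derive x (\sum_(i <- s) h 0 i *: delta_mx 0 i : 'rV[R]_d) (partials l f)
    (\sum_(i <- s) h 0 i * partials (i :: l) f x).
  elim=> [|i s IH]; first by rewrite !big_nil; exact: is_derive0.
  rewrite !big_cons addrC [X in is_derive _ _ _ X]addrC.
  apply: is_derive_addv IH _ _; last exact: (@partials_continuous (i :: l)).
  by apply: near_open Ux _ => y Uy; exact: partials_derivable.
exact.
Qed.

Lemma is_derive_partials_line l (x h : 'rV[R]_d) (t : R) :
  (size l < r)%N -> U (x + t *: h) ->
  is_derive t 1 (fun t => partials l f (x + t *: h))
    (\sum_(i < d) h 0 i * partials (i :: l) f (x + t *: h)).
Proof.
move=> lr Ux; have D := is_derive_partials h lr Ux.
by rewrite -(@derive_val _ _ _ _ _ _ _ D); exact: is_derive_line.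
Qed.

Lemma partials_even l x : (forall y, U y -> U (- y)) ->
  (forall y, f (- y) = f y) -> (size l <= r)%N -> U x ->
  partials l f (- x) = (-1) ^+ size l * partials l f x.
Proof.
move=> sU ef; elim: l x => [|i l IH] x lr Ux; first by rewrite /= mul1r ef.
have UNx := sU _ Ux; have lr' := ltnW lr.
pose e : 'rV[R]_d := delta_mx 0 i.
(* The direction [- e] is written as a zero direction plus a multiple of [e], so that
   [is_derive_addv] yields the derivative along it. *)
have D : is_derive (- x) (0 + (-1) *: e) (partials l f)
    (0 + (-1) * 'D_e (partials l f) (- x)).
  apply: is_derive_addv; first exact: is_derive0.
    by apply: near_open UNx _ => y Uy; exact: partials_derivable.
  exact: (@partials_continuous (i :: l)).
have E : 'D_e (fun y => partials l f (- y)) x = - partials (i :: l) f (- x).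
  rewrite -[- partials _ _ _]mulN1r -[RHS]add0r -(@derive_val _ _ _ _ _ _ _ D).
  apply: eq_derive_quotient => h.
  by rewrite add0r scaleN1r scalerN opprD.
apply: oppr_inj; rewrite -E (near_eq_derive (g := (-1) ^+ size l *: partials l f)).
  rewrite deriveZ; last first.
    exact: partials_derivable.
  by rewrite exprS mulN1r mulNr opprK.
by apply: near_open Ux _ => y Uy; rewrite IH.
Qed.

End Regular.

Lemma partials_shift l f c : partials l (fun u => f (u - c)) =
  fun u => partials l f (u - c).
Proof.
elim: l => //= i l ->; apply/funext => x; rewrite /partial.
by apply: eq_derive_quotient => h; rewrite addrA.
Qed.

Lemma is_derive_coord (j : 'I_d) x (v : 'rV[R]_d) :
  is_derive x v (fun u : 'rV[R]_d => u 0 j) (v 0 j).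
Proof.
suff L : (fun h : R => h^-1 *: (((fun u : 'rV[R]_d => u 0 j) \o shift x) (h *: v)
    - x 0 j)) @ 0^' --> v 0 j.
  by split; [apply/cvg_ex; eexists; exact: L | exact: cvg_lim].
apply: cvg_near_cst; near=> h; rewrite /= !mxE addrK /GRing.scale/= mulKf//.
by near: h; exact: nbhs_dnbhs_neq.
Unshelve. all: by end_near. Qed.

Lemma is_derive_peval p i x :
  is_derive x (delta_mx 0 i : 'rV[R]_d) (peval p) (peval (mderiv i p) x).
Proof.
pose P q := forall y, is_derive y (delta_mx 0 i : 'rV[R]_d) (peval q)
  (peval (mderiv i q) y).
have PC (a : R) : P (mpolyC d a).
  move=> y; rewrite mderivC /peval meval0.
  have -> : (fun u : 'rV[R]_d => meval (u 0) (mpolyC d a)) = cst a.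
    by apply/funext => u; rewrite mevalC.
  exact: is_derive_cst.
have PX j : P (mpolyX R (mnm1 j)).
  move=> y; rewrite mderivX mnm1E /peval mevalZ.
  have -> : (fun u : 'rV[R]_d => meval (u 0) (mpolyX R (mnm1 j))) = (fun u => u 0 j).
    by apply/funext => u; rewrite mevalXU.
  have -> : (j == i)%:R * meval (y 0) (mpolyX R (mnm_sub (mnm1 j) (mnm1 i))) = (delta_mx 0 i : 'rV[R]_d) 0 j.
    rewrite !mxE/=; have [->|ne] := eqVneq j i; last by rewrite mul0r.
    suff -> : mnm_sub (mnm1 i) (mnm1 i) = mnm0 by rewrite mpolyX0 meval1 mulr1.
    by apply/mnmP => a; rewrite mnmBE subnn mnm0E.
  exact: is_derive_coord.
have PM q1 q2 : P q1 -> P q2 -> P (q1 * q2).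
  move=> P1 P2 y; rewrite mderivM /peval mevalD !mevalM.
  have -> : (fun u : 'rV[R]_d => meval (u 0) (q1 * q2)) = peval q1 * peval q2.
    by apply/funext => u; rewrite mevalM.
  have := is_deriveM (P1 y) (P2 y).
  by rewrite /GRing.scale/= addrC [X in X + _]mulrC.
move: x; rewrite -/(P p).
elim/mpolyind: p => [|a m q _ _ IH]; first by rewrite -mpolyC0; exact: PC.
move=> y; rewrite mderivD /peval mevalD.
have -> : (fun u : 'rV[R]_d => meval (u 0) (a *: mpolyX R m + q)) =
    peval (a *: mpolyX R m) + peval q.
  by apply/funext => u; rewrite mevalD.
apply: is_deriveD; last exact: IH.
rewrite -mul_mpolyC; apply: (PM _ _); first exact: PC.
rewrite mpolyXE_id; apply: (big_ind P) => [|q1 q2|j _]; [|exact: PM|].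
  by rewrite -mpolyC1; exact: PC.
elim: (m j) => [|n IHn]; first by rewrite expr0 -mpolyC1; exact: PC.
by rewrite exprS; apply: PM.
Qed.

Lemma peval_continuous p : continuous (peval p : 'rV[R]_d -> R).
Proof.
have E : (peval p : 'rV[R]_d -> R) = fun x : 'rV[R]_d =>
    \sum_(m <- msupp p) mcoeff m p * \prod_(i < d) x 0 i ^+ m i.
  by apply/funext => u; rewrite /peval mevalE.
rewrite E => x; apply: (@cvg_big_sum _ _ _ _ (nbhs_filter x)) => m _.
apply: cvgM; first exact: cvg_cst.
elim: (index_enum _) => [|i s IH].
  by under eq_fun do rewrite big_nil; rewrite big_nil; exact: cvg_cst.
under eq_fun do rewrite big_cons; rewrite big_cons; apply: cvgM => //.
elim: (m i) => [|n IHn]; first by under eq_fun do rewrite expr0; exact: cvg_cst.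
under eq_fun do rewrite exprS; rewrite exprS; apply: cvgM => //.
exact: (@coord_continuous R 1 d 0 i x).
Qed.

End Partials.

(** * Finitely supported functionals and the native space *)

Section Functionals.
Context {R : realType} {I : eqType}.
Implicit Types (l : seq (R * I)) (u v : I -> R) (G : I -> I -> R).

(** Lists of weighted points serve as finitely supported functionals. Repeated points are allowed,
    so that addition is concatenation and no normal form is needed. *)
Definition lapp l u : R := \sum_(t <- l) t.1 * u t.2.

Definition lform G l1 l2 : R := lapp l1 (fun i => lapp l2 (G i)).

Definition lscale (a : R) l := [seq (a * t.1, t.2) | t <- l].

Lemma lapp_cons t l u : lapp (t :: l) u = t.1 * u t.2 + lapp l u.
Proof. by rewrite /lapp big_cons. Qed.

Lemma lapp1 i u : lapp [:: (1, i)] u = u i.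
Proof. by rewrite /lapp big_seq1 mul1r. Qed.

Lemma lapp2 (a b : R) i j u : lapp [:: (a, i); (b, j)] u = a * u i + b * u j.
Proof. by rewrite /lapp big_cons big_seq1. Qed.

Lemma lapp_cat l1 l2 u : lapp (l1 ++ l2) u = lapp l1 u + lapp l2 u.
Proof. by rewrite /lapp big_cat. Qed.

Lemma lapp_scale a l u : lapp (lscale a l) u = a * lapp l u.
Proof.
by rewrite /lapp big_map mulr_sumr; apply: eq_bigr => t _; rewrite mulrA.
Qed.

Lemma lapp_fD l u v : lapp l (fun i => u i + v i) = lapp l u + lapp l v.
Proof. by rewrite /lapp -big_split; apply: eq_bigr => t _; rewrite mulrDr. Qed.

Lemma lapp_fZ l a u : lapp l (fun i => a * u i) = a * lapp l u.
Proof. by rewrite /lapp mulr_sumr; apply: eq_bigr => t _; rewrite mulrCA. Qed.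

Lemma lapp_fN l u : lapp l (fun i => - u i) = - lapp l u.
Proof. by rewrite /lapp -sumrN; apply: eq_bigr => t _; rewrite mulrN. Qed.

Lemma lapp_fB l u v : lapp l (fun i => u i - v i) = lapp l u - lapp l v.
Proof. by rewrite lapp_fD lapp_fN. Qed.

Lemma lapp_fsum (J : Type) (s : seq J) (F : J -> I -> R) l :
  lapp l (fun i => \sum_(j <- s) F j i) = \sum_(j <- s) lapp l (F j).
Proof.
by rewrite exchange_big; apply: eq_bigr => t _; rewrite mulr_sumr.
Qed.

Lemma eq_lapp l u v : (forall t, t \in l -> u t.2 = v t.2) -> lapp l u = lapp l v.
Proof. by move=> uv; apply: eq_big_seq => t tl; rewrite uv. Qed.

Lemma lformE G l1 l2 :
  lform G l1 l2 = \sum_(s <- l1) \sum_(t <- l2) s.1 * t.1 * G s.2 t.2.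
Proof.
apply: eq_bigr => s _; rewrite mulr_sumr.
by apply: eq_bigr => t _; rewrite mulrA.
Qed.

Lemma lformC G l1 l2 : (forall i j, G i j = G j i) -> lform G l1 l2 = lform G l2 l1.
Proof.
move=> Gs; rewrite !lformE exchange_big; apply: eq_bigr => s _.
by apply: eq_bigr => t _; rewrite Gs (mulrC t.1).
Qed.

Lemma lappC (J : eqType) (l1 : seq (R * I)) (l2 : seq (R * J)) (H : I -> J -> R) :
  \sum_(s <- l1) s.1 * (\sum_(t <- l2) t.1 * H s.2 t.2) =
  \sum_(t <- l2) t.1 * (\sum_(s <- l1) s.1 * H s.2 t.2).
Proof.
under eq_bigr do rewrite mulr_sumr; rewrite exchange_big; apply: eq_bigr => t _.
by rewrite mulr_sumr; apply: eq_bigr => s _; rewrite mulrCA.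
Qed.

(** Linear extension of [F] from points to functionals; it serves to replace all derivative
    evaluations in a functional by difference quotients at once. *)
Definition lsubst (F : I -> seq (R * I)) l := flatten [seq lscale t.1 (F t.2) | t <- l].

Lemma lapp_subst F l u : lapp (lsubst F l) u = lapp l (fun i => lapp (F i) u).
Proof.
elim: l => [|t l IH]; first by rewrite /lapp !big_nil.
by rewrite /lsubst /= lapp_cat lapp_scale lapp_cons -IH.
Qed.

Lemma lform_subst F G l1 l2 :
  lform G (lsubst F l1) (lsubst F l2) = lform (fun i j => lform G (F i) (F j)) l1 l2.
Proof.
rewrite /lform lapp_subst; apply: eq_lapp => t _.
transitivity (lapp (F t.2) (fun i => lapp l2 (fun j => lapp (F j) (G i)))).
  by apply: eq_lapp => s _; rewrite lapp_subst.
exact: (lappC _ _ (fun i j => lapp (F j) (G i))).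
Qed.

Lemma lform_comb G l1 l2 a :
  lform G (l1 ++ lscale a l2) (l1 ++ lscale a l2) =
  lform G l1 l1 + a * (lform G l1 l2 + lform G l2 l1) + a ^+ 2 * lform G l2 l2.
Proof.
have E l : lapp l (fun i => lapp (l1 ++ lscale a l2) (G i)) =
    lform G l l1 + a * lform G l l2.
  rewrite -lapp_fZ -lapp_fD; apply: eq_lapp => t _.
  by rewrite lapp_cat lapp_scale.
transitivity (lform G l1 l1 + a * lform G l1 l2 +
    a * (lform G l2 l1 + a * lform G l2 l2)); last by ring.
by rewrite -!E -lapp_scale -lapp_cat.
Qed.

Lemma discriminant_le (a b c : R) : 0 <= c ->
  (forall t : R, 0 <= a + 2 * t * b + t ^+ 2 * c) -> b ^+ 2 <= a * c.
Proof.
move=> c0 H; have [c_eq0|cn0] := eqVneq c 0.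
  have [->|bn0] := eqVneq b 0; first by rewrite c_eq0 expr0n/= mulr0.
  (* For [c = 0] the polynomial is affine in [t], and at this [t] it takes the value -1. *)
  have := H (- (a + 1) / (2 * b)).
  suff -> : 2 * (- (a + 1) / (2 * b)) * b = - (a + 1) by rewrite c_eq0; lra.
  by field.
have {c0} cp : 0 < c by rewrite lt_def cn0.
have := H (- b / c).
have -> : a + 2 * (- b / c) * b + (- b / c) ^+ 2 * c = (a * c - b ^+ 2) / c by field.
by rewrite pmulr_lge0 ?invr_gt0// subr_ge0.
Qed.

(** Conditional positive definiteness speaks of pairwise distinct points, so the coefficients at
    equal points have to be collected first. *)
Lemma lapp_merge l u : lapp l u =
  \sum_(y <- undup (map snd l)) (\sum_(t <- l | t.2 == y) t.1) * u y.
Proof.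
under eq_bigr do rewrite mulr_suml big_mkcond/=.
rewrite exchange_big/= /lapp big_seq [RHS]big_seq; apply: eq_bigr => t tl.
rewrite (bigD1_seq t.2) ?undup_uniq//=; last by rewrite mem_undup map_f.
by rewrite eqxx big1 ?addr0// => i /negbTE; rewrite eq_sym => ->.
Qed.

End Functionals.

Section Native.
Context {R : realType} {d : nat}.
Variables (s : nat) (K : 'rV[R]_d -> 'rV[R]_d -> R).
Hypotheses (K_sym : symmetric_kernel K) (K_cpd : cond_posdef s K).
Implicit Types (l mu : seq (R * 'rV[R]_d)).

Lemma annihilates_cat l1 l2 : annihilates s l1 -> annihilates s l2 ->
  annihilates s (l1 ++ l2).
Proof. by move=> h1 h2 p ps; rewrite big_cat/= h1// h2// addr0. Qed.

Lemma annihilates_scale a l : annihilates s l -> annihilates s (lscale a l).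
Proof. by move=> h p ps; rewrite -/(lapp _ (peval p)) lapp_scale /lapp h// mulr0. Qed.

Lemma lform_ge0 l : annihilates s l -> 0 <= lform K l l.
Proof.
move=> al; pose pts := undup (map snd l).
pose y (i : 'I_(size pts)) := nth 0 pts i.
pose c (i : 'I_(size pts)) := \sum_(t <- l | t.2 == y i) t.1.
have E u : lapp l u = \sum_i c i * u (y i).
  by rewrite lapp_merge -/pts (big_nth 0) big_mkord.
have -> : lform K l l = \sum_i \sum_j c i * c j * K (y i) (y j).
  rewrite /lform E; apply: eq_bigr => i _; rewrite E mulr_sumr.
  by apply: eq_bigr => j _; rewrite mulrA.
(* The collected coefficients may all cancel; the strict inequality does not apply then, and the
   form is 0. *)
have [/existsP[i ci]|/existsPn c0] := boolP [exists i, c i != 0].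
  apply/ltW/K_cpd; last 2 first.
  - by exists i.
  - by move=> p ps; rewrite -(E (peval p)); exact: al.
  - move=> i1 i2 /eqP; rewrite nth_uniq ?undup_uniq// => /eqP.
    exact: val_inj.
rewrite big1// => i _; rewrite big1// => j _.
by have /negPn/eqP -> := c0 i; rewrite !mul0r.
Qed.

Lemma lform_CS l1 l2 : annihilates s l1 -> annihilates s l2 ->
  lform K l1 l2 ^+ 2 <= lform K l1 l1 * lform K l2 l2.
Proof.
move=> a1 a2; apply: discriminant_le => [|t]; first exact: lform_ge0.
have -> : lform K l1 l1 + 2 * t * lform K l1 l2 + t ^+ 2 * lform K l2 l2 =
    lform K (l1 ++ lscale t l2) (l1 ++ lscale t l2).
  by rewrite lform_comb (lformC l2 l1 K_sym); ring.
apply: lform_ge0.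
by apply: annihilates_cat => //; exact: annihilates_scale.
Qed.

(** On a kernel sum, [mu] acts as its form against the list of coefficients, because it kills the
    polynomial part; there the bound is Cauchy-Schwarz, and both sides pass to the limit. *)
Lemma native_bound f c mu : is_native_norm K s f c -> annihilates s mu ->
  lapp mu f ^+ 2 <= c ^+ 2 * lform K mu mu.
Proof.
move=> [l [p [lp _ lf lc]]] amu.
have L1 : lform K mu (l n) ^+ 2 @[n --> \oo] --> lapp mu f ^+ 2.
  have L0 : lform K mu (l n) @[n --> \oo] --> lapp mu f.
    have -> : (fun n => lform K mu (l n)) =
        (fun n => \sum_(t <- mu) t.1 * kernel_sum K (l n) (p n) t.2).
      apply/funext => n; have [an pn] := lp n.
      rewrite /kernel_sum -[RHS]/(lapp mu (fun x => lapp (l n) (K x) + peval (p n) x)).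
      by rewrite lapp_fD [X in _ + X]amu// addr0.
    apply: cvg_big_sum => t _; apply: cvgM; [exact: cvg_cst | exact: lf].
  by rewrite expr2; under eq_fun do rewrite expr2; exact: cvgM.
have L2 : sum_norm K (l n) ^+ 2 * lform K mu mu @[n --> \oo]
    --> c ^+ 2 * lform K mu mu.
  apply: cvgM; last exact: cvg_cst.
  by rewrite expr2; under eq_fun do rewrite expr2; exact: cvgM.
apply: (ler_cvg_to L1 L2); near=> n.
have [an _] := lp n.
rewrite /sum_norm -lformE sqr_sqrtr ?lform_ge0// mulrC.
exact: lform_CS.
Unshelve. all: by end_near. Qed.

Lemma native_norm_ge0 f c : is_native_norm K s f c -> 0 <= c.
Proof.
move=> [l [p [_ _ _ lc]]]; apply: (closed_cvg _ (@closed_ge _ 0) _ _ lc) => //.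
by apply: nearW => n; exact: sqrtr_ge0.
Qed.

End Native.

(** * Polynomial reproduction from finitely many points *)

Section Reproduction.
Context {R : realType} {d : nat}.
Implicit Types (p : mpoly d R) (l : seq 'I_d) (x y : 'rV[R]_d).

Definition mderivs l p : mpoly d R := foldr (@mderiv d R) p l.

Lemma partials_peval l p : partials l (peval p) = peval (mderivs l p) :> ('rV[R]_d -> R).
Proof.
elim: l => //= i l ->; apply/funext => x.
by apply: derive_val; exact: is_derive_peval.
Qed.

Lemma mderivs_linear l (c : R) p q :
  mderivs l (c *: p + q) = c *: mderivs l p + mderivs l q.
Proof.
by elim: l => //= i l; rewrite -!/(mderivs l _) => ->; rewrite mderivD mderivZ.
Qed.

Lemma pevalD p q x : peval (p + q) x = peval p x + peval q x.
Proof. exact: mevalD. Qed.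

Lemma pevalB p q x : peval (p - q) x = peval p x - peval q x.
Proof. exact: mevalB. Qed.

Lemma pevalZ a p x : peval (a *: p) x = a * peval p x.
Proof. exact: mevalZ. Qed.

Lemma peval_sum (J : Type) (s : seq J) (F : J -> mpoly d R) x :
  peval (\sum_(j <- s) F j) x = \sum_(j <- s) peval (F j) x.
Proof. exact: raddf_sum. Qed.

Lemma Pi_polyD s p q : Pi_poly s p -> Pi_poly s q -> Pi_poly s (p + q).
Proof.
by move=> ps qs; apply: leq_trans (msizeD_le _ _) _; rewrite geq_max ps.
Qed.

Lemma Pi_polyZ s a p : Pi_poly s p -> Pi_poly s (a *: p).
Proof. exact: leq_trans (msizeZ_le _ _). Qed.

Lemma Pi_poly0 s : Pi_poly s (0 : mpoly d R).
Proof. by rewrite /Pi_poly /= mmeasure0. Qed.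

Lemma Pi_polyB s p q : Pi_poly s p -> Pi_poly s q -> Pi_poly s (p - q).
Proof. by move=> ps qs; apply: Pi_polyD => //; rewrite -scaleN1r; exact: Pi_polyZ. Qed.

Lemma Pi_poly_sum s (J : Type) (r : seq J) (F : J -> mpoly d R) :
  (forall j, Pi_poly s (F j)) -> Pi_poly s (\sum_(j <- r) F j).
Proof.
by move=> Fs; elim/big_ind: _ => // [|p q]; [exact: Pi_poly0 | exact: Pi_polyD].
Qed.

(* Lagrange-type reproduction from values at points of Y, valid on Y only: a
   polynomial that is not reproduced on Y has a nonzero error at a point of Y,
   which is added to the list. *)
Lemma reproducing_points s (Y : set 'rV[R]_d) M (b : 'I_M -> mpoly d R) :
  Pi_basis s b -> exists E : seq ('rV[R]_d * mpoly d R),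
  [/\ forall e, e \in E -> Y e.1,
      forall e, e \in E -> Pi_poly s e.2 &
      forall p y, Pi_poly s p -> Y y ->
        peval p y = \sum_(e <- E) peval p e.1 * peval e.2 y].
Proof.
move=> [bs bbasis].
suff [E [EY Es Eb]] : exists E : seq ('rV[R]_d * mpoly d R),
  [/\ forall e, e \in E -> Y e.1, forall e, e \in E -> Pi_poly s e.2 &
      forall i y, i \in index_enum 'I_M -> Y y ->
        peval (b i) y = \sum_(e <- E) peval (b i) e.1 * peval e.2 y].
  exists E; split => // p y /bbasis[c [-> _]] Yy.
  rewrite peval_sum; under [RHS]eq_bigr do rewrite peval_sum mulr_suml.
  rewrite exchange_big; apply: eq_bigr => i _; rewrite pevalZ Eb ?mem_index_enum//.
  by rewrite mulr_sumr; apply: eq_bigr => e _; rewrite pevalZ mulrA.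
elim: (index_enum _) => [|i r [E [EY Es Eb]]]; first by exists [::].
pose err := b i - \sum_(e <- E) peval (b i) e.1 *: e.2.
have errs : Pi_poly s err.
  apply: Pi_polyB => //; rewrite big_seq.
  by elim/big_ind: _ => // [|p q|e eE]; [exact: Pi_poly0 | exact: Pi_polyD |
     exact/Pi_polyZ/Es].
have [err0|] := pselect (forall y, Y y -> peval err y = 0).
  exists E; split => // j y; rewrite inE => /predU1P[->|/Eb]; last exact.
  move=> Yy; have /eqP := err0 _ Yy; rewrite pevalB subr_eq0 => /eqP ->.
  by rewrite peval_sum; apply: eq_bigr => e _; rewrite pevalZ.
move=> /existsNP[y0 /not_implyP[Yy0 /eqP ey0]].
(* The new function equals 1 at [y0], and the old ones are corrected so as to vanish there. By [key]
   this adds to the old interpolant its error at [y0] times the new function, so polynomials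
   reproduced before remain so. *)
exists ((y0, (peval err y0)^-1 *: err) ::
  [seq (e.1, e.2 - (peval e.2 y0 / peval err y0) *: err) | e <- E]).
have key p y : \sum_(e <- (y0, (peval err y0)^-1 *: err) ::
    [seq (e.1, e.2 - (peval e.2 y0 / peval err y0) *: err) | e <- E])
    peval p e.1 * peval e.2 y =
  \sum_(e <- E) peval p e.1 * peval e.2 y +
  (peval p y0 - \sum_(e <- E) peval p e.1 * peval e.2 y0) * (peval err y / peval err y0).
  rewrite big_cons big_map /= pevalZ.
  under eq_bigr do rewrite pevalB pevalZ mulrBr.
  rewrite sumrB; have -> : \sum_(e <- E) peval p e.1 * (peval e.2 y0 / peval err y0 * peval err y) =
      (\sum_(e <- E) peval p e.1 * peval e.2 y0) * (peval err y / peval err y0).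
    by rewrite mulr_suml; apply: eq_bigr => e _; field.
  by field.
split.
- by move=> e; rewrite inE => /predU1P[->|/mapP[e' e'E ->]]; [exact: Yy0|exact: (EY _ e'E)].
- move=> e; rewrite inE => /predU1P[->|/mapP[e' e'E ->]]; first exact: Pi_polyZ.
  by apply: Pi_polyB; [exact: Es | exact: Pi_polyZ].
- move=> j y; rewrite inE => /predU1P[->|jr] Yy; rewrite key; last first.
    by rewrite -!Eb// subrr mul0r addr0.
  have errE u : peval (b i) u - \sum_(e <- E) peval (b i) e.1 * peval e.2 u = peval err u.
    by rewrite pevalB peval_sum; congr (_ - _); apply: eq_bigr => e _; rewrite pevalZ.
  by rewrite errE mulrC divfK// -errE addrC subrK.
Qed.

End Reproduction.

(** * Regularity of native functions *)

Section Features.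
Context {R : realType} {d : nat}.
Notation feat := (seq 'I_d * 'rV[R]_d)%type.
Implicit Types (l : seq (R * feat)) (t u : feat).

(* A feature (l, x) stands for the evaluation at x of the partial derivative
   indexed by l. *)
Definition jet (f : 'rV[R]_d -> R) t : R := partials t.1 f t.2.

(* partial_x^l partial_y^m Phi(x - y), for t = (l, x) and u = (m, y) *)
Definition jet_kernel (Phi : 'rV[R]_d -> R) t u : R :=
  (-1) ^+ size u.1 * partials (t.1 ++ u.1) Phi (t.2 - u.2).

Definition pjet (p : mpoly d R) t : R := peval (mderivs t.1 p) t.2.

Variables (s r k : nat) (Phi : 'rV[R]_d -> R) (U W Y : set 'rV[R]_d).
Hypotheses (oU : open U) (oW : open W) (CPhi : Cr_open r Phi U)
  (WY : W `<=` Y) (WYU : forall x y, W x -> Y y -> U (x - y) /\ U (y - x))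
  (k2r : (2 * k <= r)%N).
Variables (f : 'rV[R]_d -> R) (c : R).
Hypothesis fbound : forall mu, annihilates s mu ->
  lapp mu f ^+ 2 <= c ^+ 2 * lform (ti_kernel Phi) mu mu.
Variable E : seq ('rV[R]_d * mpoly d R).
Hypotheses (EY : forall e, e \in E -> Y e.1)
  (Es : forall e, e \in E -> Pi_poly s e.2)
  (Erep : forall p y, Pi_poly s p -> Y y ->
     peval p y = \sum_(e <- E) peval p e.1 * peval e.2 y).

Definition at_point (y : 'rV[R]_d) : feat := ([::], y).

(* Values and kernel after subtraction of the polynomial reproducing f at the
   points of E; for these the native-space bound holds for every functional. *)
Definition rjet t : R := jet f t - \sum_(e <- E) f e.1 * pjet e.2 t.

Definition rkernel t u : R :=
  jet_kernel Phi t u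
  - \sum_(e <- E) pjet e.2 t * jet_kernel Phi (at_point e.1) u
  - \sum_(e <- E) pjet e.2 u * jet_kernel Phi t (at_point e.1)
  + \sum_(e <- E) \sum_(e' <- E) pjet e.2 t * pjet e'.2 u *
      jet_kernel Phi (at_point e.1) (at_point e'.1).

(** Derivatives are taken only in the neighbourhood [W], whose differences with all of [Y] lie in
    the domain of smoothness [U]. At the other points of [Y], where only values of [f] are
    controlled, the list of derivatives is empty. *)
Definition admissible n t : Prop :=
  ((size t.1 <= n)%N /\ W t.2) \/ (t.1 = [::] /\ Y t.2).

Lemma lapp_rjet l : lapp l rjet = lapp l (jet f) - \sum_(e <- E) f e.1 * lapp l (pjet e.2).
Proof.
rewrite lapp_fB lapp_fsum; congr (_ - _).
by apply: eq_bigr => e _; rewrite lapp_fZ.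
Qed.

Lemma lform_rkernel l1 l2 : lform rkernel l1 l2 =
  lform (jet_kernel Phi) l1 l2
  - \sum_(e <- E) lapp l1 (pjet e.2) * lapp l2 (jet_kernel Phi (at_point e.1))
  - \sum_(e <- E) lapp l2 (pjet e.2) * lapp l1 (jet_kernel Phi ^~ (at_point e.1))
  + \sum_(e <- E) \sum_(e' <- E) lapp l1 (pjet e.2) * lapp l2 (pjet e'.2) *
      jet_kernel Phi (at_point e.1) (at_point e'.1).
Proof.
have inner t : lapp l2 (rkernel t) = lapp l2 (jet_kernel Phi t)
  - \sum_(e <- E) pjet e.2 t * lapp l2 (jet_kernel Phi (at_point e.1))
  - \sum_(e <- E) lapp l2 (pjet e.2) * jet_kernel Phi t (at_point e.1)
  + \sum_(e <- E) \sum_(e' <- E) pjet e.2 t * lapp l2 (pjet e'.2) *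
      jet_kernel Phi (at_point e.1) (at_point e'.1).
  rewrite /rkernel !lapp_fD !lapp_fN !lapp_fsum; congr (_ - _ - _ + _).
  - by apply: eq_bigr => e _; rewrite lapp_fZ.
  - apply: eq_bigr => e _; rewrite mulrC -lapp_fZ.
    by apply: eq_lapp => u _; rewrite mulrC.
  - apply: eq_bigr => e _; rewrite lapp_fsum; apply: eq_bigr => e' _.
    rewrite mulrAC -lapp_fZ.
    by apply: eq_lapp => u _; rewrite mulrAC.
rewrite [LHS]/lform (funext inner : (fun t => lapp l2 (rkernel t)) = _).
rewrite !lapp_fD !lapp_fN !lapp_fsum; congr (_ - _ - _ + _).
- by rewrite -lapp_fsum.
- apply: eq_bigr => e _; rewrite mulrC -lapp_fZ.
  by apply: eq_lapp => u _; rewrite mulrC.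
- by apply: eq_bigr => e _; rewrite lapp_fZ.
- apply: eq_bigr => e _; rewrite lapp_fsum; apply: eq_bigr => e' _.
  rewrite -mulrA mulrC -lapp_fZ.
  by apply: eq_lapp => u _; ring.
Qed.

Definition bounded_on n := forall l,
  (forall t : R * feat, t \in l -> admissible n t.2) ->
  lapp l rjet ^+ 2 <= c ^+ 2 * lform rkernel l l.

(** Subtracting from [l] its transfer to the points of [E] gives a functional [mu] that annihilates
    the polynomials; [fbound] for [mu], once expanded, is the bound for the corrected values and
    kernel. *)
Lemma bounded_on0 : bounded_on 0.
Proof.
move=> l adm.
have l0 (t : R * feat) : t \in l -> t.2 = at_point t.2.2 /\ Y t.2.2.
  move=> tl; case: t tl => a [m x] /adm /= [[]|[]] /=.
    by rewrite leqn0 => /eqP/size0nil -> /WY.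
  by move=> ->.
pose mu := [seq (t.1, t.2.2) | t : R * feat <- l] ++ [seq (- lapp l (pjet e.2), e.1) | e <- E].
have muE (v : 'rV[R]_d -> R) : lapp mu v =
    lapp l (fun t => v t.2) - \sum_(e <- E) lapp l (pjet e.2) * v e.1.
  rewrite lapp_cat /lapp !big_map; congr (_ + _).
  by rewrite -sumrN; apply: eq_bigr => e _; rewrite /= mulNr.
have amu : annihilates s mu.
  move=> p ps; rewrite -/(lapp mu (peval p)) muE; apply/eqP; rewrite subr_eq0.
  apply/eqP; under [RHS]eq_bigr do rewrite mulrC -lapp_fZ.
  rewrite -lapp_fsum; apply: eq_lapp => t /l0[-> Yt] /=.
  by rewrite (Erep ps Yt).
have := fbound amu.
have -> : lapp mu f = lapp l rjet.
  rewrite muE lapp_rjet; congr (_ - _).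
    by apply: eq_lapp => t /l0[-> _].
  by apply: eq_bigr => e _; rewrite mulrC.
suff -> : lform (ti_kernel Phi) mu mu = lform rkernel l l by [].
have K1 x y : ti_kernel Phi x y = jet_kernel Phi (at_point x) (at_point y).
  by rewrite /jet_kernel /= mul1r.
have inner x : lapp mu (ti_kernel Phi x) = lapp l (jet_kernel Phi (at_point x))
    - \sum_(e <- E) lapp l (pjet e.2) * jet_kernel Phi (at_point x) (at_point e.1).
  rewrite muE; congr (_ - _); last by apply: eq_bigr => e _; rewrite K1.
  by apply: eq_lapp => t /l0[-> _]; rewrite /= K1.
rewrite lform_rkernel /lform muE; under eq_bigr do rewrite inner mulrBr.
rewrite sumrB opprB.
have -> : lapp l (fun t => lapp mu (ti_kernel Phi t.2)) =
   lform (jet_kernel Phi) l l -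
   \sum_(e <- E) lapp l (pjet e.2) * lapp l (jet_kernel Phi ^~ (at_point e.1)).
  rewrite /lform; under [in RHS]eq_bigr do rewrite -lapp_fZ.
  rewrite -lapp_fsum -lapp_fB.
  by apply: eq_lapp => t /l0[-> _]; rewrite /= inner.
have -> : \sum_(e <- E) lapp l (pjet e.2) *
    (\sum_(e' <- E) lapp l (pjet e'.2) * jet_kernel Phi (at_point e.1) (at_point e'.1)) =
  \sum_(e <- E) \sum_(e' <- E) lapp l (pjet e.2) * lapp l (pjet e'.2) *
      jet_kernel Phi (at_point e.1) (at_point e'.1).
  by apply: eq_bigr => e _; rewrite mulr_sumr; apply: eq_bigr => e' _; rewrite mulrA.
by rewrite /lform; ring.
Qed.


Lemma cvg_quotient (g : 'rV[R]_d -> R) x v D : is_derive x v g D ->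
  (fun h : R => h^-1 * g (x + h *: v) + - h^-1 * g x) @ 0^' --> D.
Proof.
move=> [dg <-].
have -> : (fun h : R => h^-1 * g (x + h *: v) + - h^-1 * g x) =
    (fun h : R => h^-1 *: ((g \o shift x) (h *: v) - g x)).
  by apply/funext => h; rewrite /= mulNr -mulrBr [x + _]addrC.
exact: dg.
Qed.

(* Replaces the derivatives of order n + 1 by difference quotients. *)
Definition dquot n (h : R) t : seq (R * feat) :=
  if t.1 is i :: m then
    if size m == n then
      [:: (h^-1, (m, t.2 + h *: (delta_mx 0 i : 'rV[R]_d))); (- h^-1, (m, t.2))]
    else [:: (1, t)]
  else [:: (1, t)].

Variant dquot_spec n t : Prop :=
| DquotOld of admissible n t & forall h, dquot n h t = [:: (1, t)]
| DquotNew i m x of size m = n & W x & t = (i :: m, x) &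
    forall h, dquot n h t =
      [:: (h^-1, (m, x + h *: (delta_mx 0 i : 'rV[R]_d))); (- h^-1, (m, x))].

Lemma dquotP n t : admissible n.+1 t -> dquot_spec n t.
Proof.
case: t => [[|i m] x] /=.
  by case=> [[_ /WY]|[_]] Yx; apply: DquotOld => //; right.
case=> [[/= mn Wx]|[//]]; have [mE|/eqP mE] := @eqP _ (size m) n.
  by apply: (@DquotNew _ _ i m x) => // h; rewrite /dquot /= mE eqxx.
apply: DquotOld => [|h]; last by rewrite /dquot /= (negbTE mE).
by left; split => //=; rewrite ltn_neqAle mE.
Qed.

Lemma is_derive_pjet p i m x :
  is_derive x (delta_mx 0 i : 'rV[R]_d) (fun x => pjet p (m, x)) (pjet p (i :: m, x)).
Proof. exact: is_derive_peval. Qed.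

Lemma dquot_pjet n p t : admissible n.+1 t ->
  lapp (dquot n h t) (pjet p) @[h --> 0^'] --> pjet p t.
Proof.
move=> /dquotP; case=> [_ tE|i m x mn Wx -> tE].
  by under eq_fun do rewrite tE lapp1; exact: cvg_cst.
under eq_fun do rewrite tE lapp2.
exact: (cvg_quotient (is_derive_pjet p i m x)).
Qed.

Lemma admissible_sub n t u : (2 * n < r)%N -> W t.2 -> (size t.1 <= n)%N ->
  admissible n u -> (size (t.1 ++ u.1) < r)%N /\ U (t.2 - u.2).
Proof.
move=> nr Wt tn au; have Yu : Y u.2 by case: au => [[_ /WY]|[]].
split; last exact: (WYU Wt Yu).1.
rewrite size_cat (leq_ltn_trans _ nr)// mul2n -addnn leq_add//.
by case: au => [[]|[->]].
Qed.

Lemma is_derive_kernell i m x u : U (x - u.2) -> (size (m ++ u.1) < r)%N ->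
  is_derive x (delta_mx 0 i : 'rV[R]_d) (fun x => jet_kernel Phi (m, x) u)
    (jet_kernel Phi (i :: m, x) u).
Proof.
move=> Ux lr.
have D : is_derive x (delta_mx 0 i : 'rV[R]_d)
    (fun x => partials (m ++ u.1) Phi (x - u.2))
    (partials (i :: m ++ u.1) Phi (x - u.2)).
  have D := derivableP (partials_derivable (i := i) CPhi Ux lr).
  apply: (is_derive_quotient _ D) => h.
  by rewrite addrA.
exact: (is_deriveZ ((-1) ^+ size u.1) D).
Qed.

(** The inner derivative -1 is absorbed by the sign in [jet_kernel]. The new index belongs in the
    middle of the list, which requires symmetry of the partial derivatives. *)
Lemma is_derive_kernelr j t m y : U (t.2 - y) -> (size (t.1 ++ m) < r)%N ->
  is_derive y (delta_mx 0 j : 'rV[R]_d) (fun y => jet_kernel Phi t (m, y))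
    (jet_kernel Phi t (j :: m, y)).
Proof.
move=> Uy lr; have pE : partials (t.1 ++ j :: m) Phi (t.2 - y) =
    partials (j :: t.1 ++ m) Phi (t.2 - y).
  apply: (partials_perm oU CPhi _ _ Uy); last by rewrite size_cat /= addnS -size_cat.
  by rewrite -cat1s perm_catCA.
have D := is_derive_partials oU CPhi (- delta_mx 0 j) lr Uy.
have DE : \sum_(i < d) (- delta_mx 0 j : 'rV[R]_d) 0 i *
    partials (i :: t.1 ++ m) Phi (t.2 - y) = - partials (t.1 ++ j :: m) Phi (t.2 - y).
  rewrite pE (bigD1 j)//= !mxE !eqxx/= mulN1r big1 ?addr0// => i ij.
  by rewrite !mxE/= (negbTE ij) oppr0 mul0r.
rewrite DE in D.
have {}D : is_derive y (delta_mx 0 j : 'rV[R]_d)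
    (fun y => partials (t.1 ++ m) Phi (t.2 - y)) (- partials (t.1 ++ j :: m) Phi (t.2 - y)).
  apply: (is_derive_quotient _ D) => h.
  by rewrite scalerN opprD addrCA addrA.
rewrite {2}/jet_kernel /= exprS mulN1r mulNr -mulrN.
exact: (is_deriveZ ((-1) ^+ size m) D).
Qed.


Notation dnbhs2 := (filter_prod (0 : R)^' (0 : R)^').

(** The two steps tend to 0 independently, since the Cauchy criterion compares quotients with
    different steps. If both features are replaced, the form is a second difference quotient with
    steps [z.1] and [- z.2], to which [mixed_difference] applies. *)
Lemma dquot_kernel n t u : (2 * n.+1 <= r)%N ->
  admissible n.+1 t -> admissible n.+1 u ->
  (fun z : R * R => lform (jet_kernel Phi) (dquot n z.1 t) (dquot n z.2 u))
    @ dnbhs2 --> jet_kernel Phi t u.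
Proof.
move=> nr at1 au1; have nr' : (2 * n < r)%N.
  by apply: leq_trans nr; rewrite !mul2n doubleS ltnW.
have [at0 tE|i m x mn Wx tE' tE] := dquotP at1;
  have [au0 uE|j m' y mn' Wy uE' uE] := dquotP au1.
- under eq_fun do rewrite tE uE /lform !lapp1; exact: cvg_cst.
- under eq_fun do rewrite tE uE /lform lapp1 lapp2.
  have Ut : (size (t.1 ++ m') < r)%N /\ U (t.2 - y).
    have Yt : Y t.2 by case: at0 => [[_ /WY]|[]].
    split; last exact: (WYU Wy Yt).2.
    rewrite size_cat (leq_ltn_trans _ nr')// mul2n -addnn leq_add ?mn'//.
    by case: at0 => [[]|[->]].
  have D := is_derive_kernelr j Ut.2 Ut.1.
  rewrite uE'; apply: (cvg_comp _ _ _ (cvg_quotient D)).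
  exact: cvg_snd.
- under eq_fun do rewrite tE uE /lform lapp2 !lapp1.
  have [|lr Ux] := @admissible_sub n (m, x) u nr' Wx _ au0; first by rewrite /= mn.
  have D := is_derive_kernell i Ux lr.
  rewrite tE'; apply: (cvg_comp _ _ _ (cvg_quotient D)).
  exact: cvg_fst.
- under eq_fun do rewrite tE uE /lform !lapp2.
  set e1 : 'rV[R]_d := delta_mx 0 i; set e2 : 'rV[R]_d := delta_mx 0 j.
  pose psi := partials (m ++ m') Phi; pose p := x - y.
  have Up : U p by exact: (WYU Wx (WY Wy)).1.
  have lr2 : ((size (m ++ m')).+2 <= r)%N.
    by rewrite size_cat mn mn' addnn -doubleS -mul2n.
  have lr1 : (size (m ++ m') < r)%N by exact: ltnW.
  have tuE : jet_kernel Phi t u = (-1) ^+ size m' * - 'D_e2 ('D_e1 psi) p.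
    have pE : partials ((i :: m) ++ j :: m') Phi p = partials [:: j, i & m ++ m'] Phi p.
      apply: (partials_perm oU CPhi _ _ Up); last by rewrite /= size_cat /= addnS -size_cat.
      by rewrite -[j :: m']cat1s perm_catCA.
    rewrite tE' uE' /jet_kernel -/p pE exprS mulN1r mulNr mulrN.
    by [].
  apply/cvgrPdistC_le => eps eps0.
  have H1 : \forall z \near p, derivable psi z e1.
    by apply: (near_open oU Up) => z Uz; exact: (partials_derivable (i := i) CPhi Uz).
  have H2 : \forall z \near p, derivable ('D_e1 psi) z e2.
    apply: (near_open oU Up) => z Uz.
    exact: (partials_derivable (l := i :: m ++ m') (i := j) CPhi Uz).
  have H3 : {for p, continuous ('D_e2 ('D_e1 psi))}.
    exact: (partials_continuous (l := [:: j, i & m ++ m']) CPhi Up).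
  have [del del0 H] := mixed_difference H1 H2 H3 eps0.
  near=> z.
  have z1 : z.1 != 0 by near: z; apply: (cvg_fst (nbhs_dnbhs_neq _)).
  have z2 : z.2 != 0 by near: z; apply: (cvg_snd (nbhs_dnbhs_neq _)).
  have z1d : `|z.1| <= del by near: z; apply: (cvg_fst (dnbhs0_le _)).
  have z2d : `|- z.2| <= del by rewrite normrN; near: z; apply: (cvg_snd (dnbhs0_le _)).
  have := H _ _ z1d z2d.
  have KE a b : jet_kernel Phi (m, a) (m', b) = (-1) ^+ size m' * psi (a - b) by [].
  have F1 : x + z.1 *: e1 - (y + z.2 *: e2) = p + z.1 *: e1 + (- z.2) *: e2.
    by rewrite scaleNr opprD addrACA addrA.
  have F2 : x + z.1 *: e1 - y = p + z.1 *: e1 by rewrite addrAC.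
  have F3 : x - (y + z.2 *: e2) = p + (- z.2) *: e2 by rewrite scaleNr opprD addrA.
  rewrite tuE !KE F1 F2 F3 -/p.
  have s1 : `|(-1) ^+ size m' : R| = 1 by rewrite normrX normrN1 expr1n.
  set A1 := psi (_ + _ + _); set A2 := psi (p + z.1 *: e1).
  set A3 := psi (p + - z.2 *: e2); set A4 := psi p; set D := 'D_e2 _ p => HH.
  have -> : forall s0 : R, z.1^-1 * (z.2^-1 * (s0 * A1) + - z.2^-1 * (s0 * A2)) +
     - z.1^-1 * (z.2^-1 * (s0 * A3) + - z.2^-1 * (s0 * A4)) - s0 * - D =
     s0 * (- ((A1 - A2 - A3 + A4 - D * (z.1 * - z.2)) / (z.1 * - z.2))).
    by move=> s0; field; rewrite z1 z2.
  rewrite normrM normrN normf_div s1 mul1r.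
  by rewrite ler_pdivrMr// normr_gt0 mulf_neq0// oppr_eq0.
Unshelve. all: by end_near. Qed.


Lemma admissible_at n e : e \in E -> admissible n (at_point e.1).
Proof. by move=> eE; right; split => //; exact: EY. Qed.

Lemma dquot_rkernel n t u : (2 * n.+1 <= r)%N ->
  admissible n.+1 t -> admissible n.+1 u ->
  (fun z : R * R => lform rkernel (dquot n z.1 t) (dquot n z.2 u))
    @ dnbhs2 --> rkernel t u.
Proof.
move=> nr at1 au1; under eq_fun do rewrite lform_rkernel.
have c1 p v : admissible n.+1 v ->
    (fun z : R * R => lapp (dquot n z.1 v) (pjet p)) @ dnbhs2 --> pjet p v.
  by move=> av; apply: (cvg_comp _ _ _ (dquot_pjet (p := p) av)); exact: cvg_fst.
have c2 p v : admissible n.+1 v ->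
    (fun z : R * R => lapp (dquot n z.2 v) (pjet p)) @ dnbhs2 --> pjet p v.
  by move=> av; apply: (cvg_comp _ _ _ (dquot_pjet (p := p) av)); exact: cvg_snd.
apply: cvgD; first apply: cvgB; first apply: cvgB.
- exact: dquot_kernel.
- apply: cvg_big_sum => e eE; apply: cvgM; first exact: c1.
  have := dquot_kernel nr (admissible_at n.+1 eE) au1.
  by under eq_fun do rewrite /lform lapp1.
- apply: cvg_big_sum => e eE; apply: cvgM; first exact: c2.
  have EK (z : R * R) :
      lform (jet_kernel Phi) (dquot n z.1 t) (dquot n z.2 (at_point e.1)) =
      lapp (dquot n z.1 t) (jet_kernel Phi ^~ (at_point e.1)).
    by apply: eq_lapp => v _; exact: lapp1.
  have := dquot_kernel nr at1 (admissible_at n.+1 eE).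
  by under eq_fun do rewrite EK.
- apply: cvg_big_sum => e eE; apply: cvg_big_sum => e' eE'.
  by apply: cvgM; [apply: cvgM; [exact: c1 | exact: c2] | exact: cvg_cst].
Qed.

Lemma cvg_dnbhs2_fst : (z.1, z.1) @[z --> dnbhs2] --> dnbhs2.
Proof. exact: (cvg_pair (f := @fst R R) (g := @fst R R) cvg_fst cvg_fst). Qed.

Lemma cvg_dnbhs2_snd : (z.2, z.2) @[z --> dnbhs2] --> dnbhs2.
Proof. exact: (cvg_pair (f := @snd R R) (g := @snd R R) cvg_snd cvg_snd). Qed.

Lemma cvg_dnbhs2_swap : (z.2, z.1) @[z --> dnbhs2] --> dnbhs2.
Proof. exact: (cvg_pair (f := @snd R R) (g := @fst R R) cvg_snd cvg_fst). Qed.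

Lemma cvg_dnbhs2_diag : (h, h) @[h --> (0 : R)^'] --> dnbhs2.
Proof. exact: (cvg_pair (f := @id R) (g := @id R) cvg_id cvg_id). Qed.

Lemma dquot_admissible n t : admissible n.+1 t ->
  \forall h \near (0 : R)^', forall v, v \in dquot n h t -> admissible n v.2.
Proof.
move=> /dquotP[at0 tE|i m x mn Wx _ tE].
  by near=> h; move=> v; rewrite tE inE => /eqP ->.
have : \forall h \near (0 : R)^', W (x + h *: (delta_mx 0 i : 'rV[R]_d)).
  have nW : \forall z \near x, W z by exact: open_nbhs_nbhs.
  have [e e0 eW] := near_box (delta_mx 0 i : 'rV[R]_d) 0 nW.
  near=> h; rewrite -[_ + _]addr0 -(scaler0 _ (0 : R)); apply: eW.
    by near: h; exact: dnbhs0_le.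
  by rewrite normr0 ltW.
apply: filterS => h Wh v; rewrite tE !inE => /orP[]/eqP ->; left; split => //=;
  by rewrite mn.
Unshelve. all: by end_near. Qed.

Section Step.
Variable n : nat.
Hypotheses (nr : (2 * n.+1 <= r)%N) (bn : bounded_on n).

Lemma rjet_quotient_cvg t : admissible n.+1 t ->
  cvg (lapp (dquot n h t) rjet @[h --> (0 : R)^']).
Proof.
move=> at1; apply: cauchy_cvg; apply/cauchy_ballP => e e0.
pose D (z : R * R) := lform rkernel
  (dquot n z.1 t ++ lscale (-1) (dquot n z.2 t))
  (dquot n z.1 t ++ lscale (-1) (dquot n z.2 t)).
have Dcvg : c ^+ 2 * D z @[z --> dnbhs2] --> (0 : R).
  have G := dquot_rkernel nr at1 at1.
  have G1 := cvg_comp _ _ cvg_dnbhs2_fst G.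
  have G2 := cvg_comp _ _ cvg_dnbhs2_snd G.
  have G3 := cvg_comp _ _ cvg_dnbhs2_swap G.
  rewrite /comp /= in G1 G2 G3.
  (* All four entries of the form of a difference of two quotients tend to [rkernel t t], with total
     coefficient 1 - 2 + 1 = 0. *)
  rewrite [X in _ --> X](_ : _ = c ^+ 2 * (rkernel t t +
    (-1) * (rkernel t t + rkernel t t) + (-1) ^+ 2 * rkernel t t)); last by ring.
  apply: cvgM; first exact: cvg_cst.
  rewrite /D; under eq_fun do rewrite lform_comb.
  apply: cvgD; first apply: cvgD.
  - exact: G1.
  - apply: cvgM; first exact: cvg_cst.
    by apply: cvgD => //; exact: G3.
  - apply: cvgM; first exact: cvg_cst.
    exact: G2.
have Dlt : \forall z \near dnbhs2, c ^+ 2 * D z < e ^+ 2.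
  by apply: (cvgr_lt _ Dcvg); rewrite exprn_gt0.
have A1 : \forall z \near dnbhs2, forall v, v \in dquot n z.1 t -> admissible n v.2.
  exact: (cvg_fst (dquot_admissible at1)).
have A2 : \forall z \near dnbhs2, forall v, v \in dquot n z.2 t -> admissible n v.2.
  exact: (cvg_snd (dquot_admissible at1)).
have [[P Q] /= [P0 Q0] PQ] := filterI Dlt (filterI A1 A2).
exists ((fun h => lapp (dquot n h t) rjet) @` P, (fun h => lapp (dquot n h t) rjet) @` Q).
  by split; [apply: filterS P0 | apply: filterS Q0] => h hP; exists h.
move=> [_ _] /= [[h Ph <-] [h' Qh' <-]].
have [Dlt' [a1 a2]] := PQ (h, h') (conj Ph Qh').
rewrite -ball_normE /= -(ltr_pXn2r (n := 2)) ?nnegrE ?(ltW e0)//.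
apply: le_lt_trans Dlt'; rewrite real_normK ?num_real//.
have := bn (l := dquot n h t ++ lscale (-1) (dquot n h' t)).
rewrite lapp_cat lapp_scale mulN1r; apply => v.
by rewrite mem_cat => /orP[/a1//|/mapP[w /a2 aw ->]].
Qed.

Lemma partials_derivable_native i m x : size m = n -> W x ->
  derivable (partials m f) x (delta_mx 0 i : 'rV[R]_d).
Proof.
move=> mn Wx; pose t : feat := (i :: m, x).
have at1 : admissible n.+1 t by left; split => //=; rewrite mn.
have qE h : dquot n h t =
    [:: (h^-1, (m, x + h *: (delta_mx 0 i : 'rV[R]_d))); (- h^-1, (m, x))].
  by rewrite /dquot /= mn eqxx.
have := rjet_quotient_cvg at1.
move=> /cvg_ex[L HL]; apply/cvg_ex; exists (L + \sum_(e <- E) f e.1 * pjet e.2 t).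
rewrite [X in X @ _](_ : _ = fun h : R => lapp (dquot n h t) rjet +
    \sum_(e <- E) f e.1 * lapp (dquot n h t) (pjet e.2)); last first.
  apply/funext => h; rewrite lapp_rjet subrK qE lapp2 /= mulNr -mulrBr.
  by rewrite [x + _]addrC.
apply: cvgD => //; apply: cvg_big_sum => e _; apply: cvgM; first exact: cvg_cst.
exact: dquot_pjet.
Qed.

Lemma dquot_rjet t : admissible n.+1 t ->
  lapp (dquot n h t) rjet @[h --> (0 : R)^'] --> rjet t.
Proof.
move=> at1; under eq_fun do rewrite lapp_rjet.
apply: cvgB; last first.
  apply: cvg_big_sum => e _; apply: cvgM; first exact: cvg_cst.
  exact: dquot_pjet.
have [_ tE|i m x mn Wx tE' tE] := dquotP at1.
  by under eq_fun do rewrite tE lapp1; exact: cvg_cst.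
under eq_fun do rewrite tE lapp2; rewrite tE'.
have D : is_derive x (delta_mx 0 i : 'rV[R]_d) (fun x => jet f (m, x))
  (jet f (i :: m, x)) := derivableP (partials_derivable_native (i := i) mn Wx).
exact: (cvg_quotient D).
Qed.

(** With one common step [h], every derivative of order [n + 1] is replaced by its quotient; for
    small [h] the result is admissible of order [n], and the bound passes to the limit. *)
Lemma bounded_onS : bounded_on n.+1.
Proof.
move=> l adm.
pose lh h := lsubst (dquot n h) l.
have L1 : lapp (lh h) rjet ^+ 2 @[h --> (0 : R)^'] --> lapp l rjet ^+ 2.
  suff L0 : lapp (lh h) rjet @[h --> (0 : R)^'] --> lapp l rjet.
    by rewrite expr2; under eq_fun do rewrite expr2; exact: cvgM.
  under eq_fun do rewrite lapp_subst.
  apply: cvg_big_sum => t tl; apply: cvgM; first exact: cvg_cst.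
  exact/dquot_rjet/adm.
have L2 : c ^+ 2 * lform rkernel (lh h) (lh h) @[h --> (0 : R)^'] -->
    c ^+ 2 * lform rkernel l l.
  apply: cvgM; first exact: cvg_cst.
  under eq_fun do rewrite lform_subst.
  apply: cvg_big_sum => t tl; apply: cvgM; first exact: cvg_cst.
  apply: cvg_big_sum => u ul; apply: cvgM; first exact: cvg_cst.
  exact: (cvg_comp _ _ cvg_dnbhs2_diag (dquot_rkernel nr (adm _ tl) (adm _ ul))).
apply: (ler_cvg_to L1 L2).
have : \forall h \near (0 : R)^', forall t : R * feat, t \in l ->
    forall v, v \in dquot n h t.2 -> admissible n v.2.
  elim: l adm {lh L1 L2} => [|t l IH] adm; first by apply: nearW => h t; rewrite in_nil.
  have H1 := dquot_admissible (adm t (mem_head _ _)).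
  have H2 : \forall h \near (0 : R)^', forall t : R * feat, t \in l ->
      forall v, v \in dquot n h t.2 -> admissible n v.2.
    by apply: IH => u ul; apply: adm; rewrite inE ul orbT.
  by apply: filterS2 H1 H2 => h h1 h2 u; rewrite inE => /predU1P[->|/h2].
apply: filterS => h ah; apply: bn => v.
by move=> /flattenP[_ /mapP[t tl ->] /mapP[w wd ->]]; exact: ah wd.
Qed.

End Step.


Lemma bounded_on_le n : (2 * n <= r)%N -> bounded_on n.
Proof.
elim: n => [_|n IH nr]; first exact: bounded_on0.
apply: bounded_onS => //; apply: IH; apply: leq_trans nr.
by rewrite leq_mul2l leqnSn.
Qed.

Lemma cvg_rkernel m x (u v : 'rV[R]_d -> 'rV[R]_d) : (2 * size m <= r)%N -> W x ->
  u y @[y --> x] --> x -> v y @[y --> x] --> x ->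
  rkernel (m, u y) (m, v y) @[y --> x] --> rkernel (m, x) (m, x).
Proof.
move=> mr Wx ux vx.
have FF := nbhs_filter x.
have CR (a : R) := @cvg_cst R a 'rV[R]_d (nbhs x) FF.
have CV (a : 'rV[R]_d) := @cvg_cst 'rV[R]_d a 'rV[R]_d (nbhs x) FF.
have K (l : seq 'I_d) (g : 'rV[R]_d -> 'rV[R]_d) p a : (size l <= r)%N -> U p ->
    g y @[y --> x] --> p ->
    (a * partials l Phi (g y)) @[y --> x] --> a * partials l Phi p.
  move=> lr Up gp; apply: cvgM; first exact: CR.
  exact: (cvg_comp _ _ gp (partials_continuous CPhi Up lr)).
have P (g : 'rV[R]_d -> 'rV[R]_d) p : g y @[y --> x] --> x ->
    pjet p (m, g y) @[y --> x] --> pjet p (m, x).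
  by move=> gx; exact: (cvg_comp _ _ gx (@peval_continuous R d (mderivs m p) x)).
have mr1 : (size m <= r)%N by apply: leq_trans mr; rewrite leq_pmull.
apply: cvgD; first apply: cvgB; first apply: cvgB.
- apply: K; first by rewrite size_cat addnn -mul2n.
    exact: (WYU Wx (WY Wx)).1.
  exact: cvgB.
- apply: (@cvg_big_sum _ _ _ _ FF) => e eE; apply: cvgM; first exact: P.
  apply: K => //; first exact: (WYU Wx (EY eE)).2.
  by apply: cvgB => //; exact: CV.
- apply: (@cvg_big_sum _ _ _ _ FF) => e eE; apply: cvgM; first exact: P.
  rewrite /jet_kernel /= cats0; apply: K => //; first exact: (WYU Wx (EY eE)).1.
  by apply: cvgB => //; exact: CV.
- apply: (@cvg_big_sum _ _ _ _ FF) => e eE; apply: (@cvg_big_sum _ _ _ _ FF) => e' eE'.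
  by apply: cvgM; [apply: cvgM; exact: P | exact: CR].
Qed.

(** The bound is applied to the difference of the evaluations at [x] and [y]. Its form is continuous
    in [y] and vanishes at [y = x]. *)
Lemma partials_continuous_native m x : (2 * size m <= r)%N -> W x ->
  {for x, continuous (partials m f)}.
Proof.
move=> mr Wx; have FF := nbhs_filter x.
have CR (a : R) := @cvg_cst R a 'rV[R]_d (nbhs x) FF.
have CV (a : 'rV[R]_d) := @cvg_cst 'rV[R]_d a 'rV[R]_d (nbhs x) FF.
suff L : rjet (m, y) @[y --> x] --> rjet (m, x).
  have -> : partials m f = fun y => rjet (m, y) + \sum_(e <- E) f e.1 * pjet e.2 (m, y).
    by apply/funext => y; rewrite subrK.
  apply: cvgD => //; apply: (@cvg_big_sum _ _ _ _ FF) => e _; apply: cvgM; first exact: CR.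
  exact: peval_continuous.
pose D y := rkernel (m, x) (m, x) + (-1) * (rkernel (m, x) (m, y) + rkernel (m, y) (m, x))
  + (-1) ^+ 2 * rkernel (m, y) (m, y).
have Dcvg : c ^+ 2 * D y @[y --> x] --> (0 : R).
  rewrite [X in _ --> X](_ : _ = c ^+ 2 * D x); last by rewrite /D; ring.
  apply: cvgM; first exact: CR.
  apply: cvgD; first apply: cvgD; first exact: CR.
    apply: cvgM; first exact: CR.
    apply: cvgD.
      by apply: (cvg_rkernel (u := fun=> x) (v := id)) => //; exact: CV.
    by apply: (cvg_rkernel (u := id) (v := fun=> x)) => //; exact: CV.
  apply: cvgM; first exact: CR.
  exact: (cvg_rkernel (u := id) (v := id)).
apply/cvgrPdist_lt => e e0.
have Dlt : \forall y \near x, c ^+ 2 * D y < e ^+ 2.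
  by apply: (cvgr_lt _ Dcvg); rewrite exprn_gt0.
have nW : \forall y \near x, W y by exact: open_nbhs_nbhs.
apply: filterS2 Dlt nW => y Dy Wy.
rewrite -(ltr_pXn2r (n := 2)) ?nnegrE ?(ltW e0)//.
apply: le_lt_trans Dy; rewrite real_normK ?num_real//.
have := @bounded_on_le (size m) mr ([:: (1, (m, x))] ++ lscale (-1) [:: (1, (m, y))]).
rewrite lapp_cat lapp_scale lform_comb !lapp1 mulN1r /lform !lapp1; apply => v.
by rewrite /lscale !inE => /orP[]/eqP -> /=; left.
Qed.

Lemma Cr_open_native : Cr_open k f W.
Proof.
move=> m x Wx; split=> mk => [|i].
  by apply: partials_continuous_native => //; apply: leq_trans k2r; rewrite leq_mul2l.
have mr : (2 * (size m).+1 <= r)%N by apply: leq_trans k2r; rewrite leq_mul2l.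
apply: (partials_derivable_native mr) => //; apply: bounded_on_le.
by apply: leq_trans mr; rewrite leq_mul2l leqnSn.
Qed.

(* On functionals annihilating polynomials the correction terms vanish. *)
Lemma native_jet_bound l : (forall t : R * feat, t \in l -> admissible k t.2) ->
  (forall p, Pi_poly s p -> lapp l (pjet p) = 0) ->
  lapp l (jet f) ^+ 2 <= c ^+ 2 * lform (jet_kernel Phi) l l.
Proof.
move=> adm l0; have := bounded_on_le k2r adm.
rewrite lapp_rjet lform_rkernel.
rewrite [X in lapp l (jet f) - X]big1_seq ?subr0; last first.
  by move=> e /andP[_ eE]; rewrite l0 ?mulr0//; exact: Es.
rewrite [X in _ - X - _]big1_seq ?subr0; last first.
  by move=> e /andP[_ eE]; rewrite l0 ?mul0r//; exact: Es.
rewrite [X in _ - X + _]big1_seq ?subr0; last first.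
  by move=> e /andP[_ eE]; rewrite l0 ?mul0r//; exact: Es.
rewrite big1_seq ?addr0// => e /andP[_ eE]; rewrite big1// => e' _.
by rewrite l0 ?mul0r//; exact: Es.
Qed.

End Features.

(** * Duality of weighted maximum and sum norms *)

Section Duality.
Context {R : realType} {V : lmodType R}.
Variable S : set V.
Hypotheses (S0 : S 0) (SD : forall (a : R) x y, S x -> S y -> S (a *: x + y)).

Definition linear_form (u : V -> R) :=
  forall (a : R) x y, u (a *: x + y) = a * u x + u y.

Lemma linear_form0 u : linear_form u -> u 0 = 0.
Proof.
move=> ul; have := ul 1 0 0; rewrite scaler0 addr0 mul1r => /eqP.
by rewrite -subr_eq0 opprD addNKr oppr_eq0 => /eqP.
Qed.

Lemma linear_formZ u a x : linear_form u -> u (a *: x) = a * u x.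
Proof. by move=> ul; rewrite -[a *: x]addr0 ul linear_form0// addr0. Qed.

Lemma linear_form_sum (J : Type) (s : seq J) (t : J -> R) (x : J -> V) u :
  linear_form u -> u (\sum_(j <- s) t j *: x j) = \sum_(j <- s) t j * u (x j).
Proof.
move=> ul; elim: s => [|j s IH]; first by rewrite !big_nil linear_form0.
by rewrite !big_cons ul IH.
Qed.

(* One step of Hahn-Banach: the value function y |-> sup {phi x | x in C,
   e x = y} is concave and at most rho on [-b, b], so it lies below a line
   through (b, rho). *)
Lemma supporting_slope (C : set V) (phi e : V -> R) (b rho : R) x1 :
  linear_form phi -> linear_form e -> 0 <= b ->
  (forall x, C x -> C (- x)) ->
  (forall (t : R) x y, 0 <= t <= 1 -> C x -> C y -> C (t *: x + (1 - t) *: y)) ->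
  (forall x, C x -> `|e x| <= b -> phi x <= rho) ->
  C x1 -> b < e x1 -> rho < phi x1 ->
  exists2 c, 0 <= c & forall x, C x -> phi x - c * e x <= rho - c * b.
Proof.
move=> phil el b0 CN Cc Crho Cx1 bx1 rx1.
(* The convex combination of [y] and [x] on which [e] equals [b] has [phi <= rho]. Hence the slopes
   of chords from [(b, rho)] to points on the right are at most those to points on the left, and the
   supremum of the former separates them. *)
have key y x : C y -> C x -> b < e y -> e x < b ->
    (phi y - rho) / (e y - b) <= (rho - phi x) / (b - e x).
  move=> Cy Cx by_ xb.
  have yx : 0 < e y - e x by rewrite subr_gt0 (lt_trans xb).
  pose t := (b - e x) / (e y - e x).
  have t01 : 0 <= t <= 1.
    rewrite /t ler_pdivrMr// mul1r lerD2r (ltW by_) andbT.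
    by apply: divr_ge0; [rewrite subr_ge0 ltW | exact: ltW].
  have eu (u : V -> R) : linear_form u -> u (t *: y + (1 - t) *: x) = t * u y + (1 - t) * u x.
    by move=> ul; rewrite ul linear_formZ.
  have := Crho _ (Cc t y x t01 Cy Cx); rewrite !eu//.
  have -> : t * e y + (1 - t) * e x = b by rewrite /t; field; rewrite gt_eqF.
  rewrite (ger0_norm b0) lexx => /(_ isT).
  have -> : t * phi y + (1 - t) * phi x =
      ((b - e x) * phi y + (e y - b) * phi x) / (e y - e x).
    by rewrite /t; field; rewrite gt_eqF.
  rewrite ler_pdivrMr// => H.
  rewrite ler_pdivrMr ?subr_gt0// mulrAC ler_pdivlMr ?subr_gt0//; lra.
(* The reflected point lies to the left of [b] and bounds the set of slopes from above. *)
have Nx1b : e (- x1) < b.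
  rewrite -scaleN1r linear_formZ// mulN1r ltrNl.
  by apply: le_lt_trans bx1; rewrite -subr_ge0 opprK addr_ge0.
pose A := [set (phi y - rho) / (e y - b) | y in [set y | C y /\ b < e y]].
have A1 : A ((phi x1 - rho) / (e x1 - b)) by exists x1.
have ubA x : C x -> e x < b -> ubound A ((rho - phi x) / (b - e x)).
  by move=> Cx xb _ [y [Cy by_] <-]; exact: key.
have supA : has_sup A.
  split; first by exists ((phi x1 - rho) / (e x1 - b)).
  by exists ((rho - phi (- x1)) / (b - e (- x1))); apply: ubA => //; exact: CN.
exists (sup A).
  apply: le_trans (ub_le_sup supA.2 A1).
  by rewrite divr_ge0// subr_ge0 ltW.
move=> x Cx; have [xb|bx|xb] := ltgtP (e x) b.
- have : sup A <= (rho - phi x) / (b - e x).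
    by apply: ge_sup; [exact: supA.1 | exact: ubA].
  by rewrite ler_pdivlMr ?subr_gt0//; lra.
- have : (phi x - rho) / (e x - b) <= sup A.
    by apply: ub_le_sup; [exact: supA.2 | exists x].
  by rewrite ler_pdivrMr ?subr_gt0//; lra.
- by rewrite xb lerD2r; apply: Crho => //; rewrite xb ger0_norm.
Qed.

(** Induction on the number of constraints, with a Lagrange multiplier [c] for the first: under the
    remaining ones [phi - c * e ord0] is at most [rho - |c| * b ord0]. With no constraint left, a
    linear form bounded above on the subspace [S] vanishes on it. *)
Lemma l1_duality N (phi : V -> R) (e : 'I_N -> V -> R) (b : 'I_N -> R) (rho : R) :
  linear_form phi -> (forall i, linear_form (e i)) -> (forall i, 0 <= b i) ->
  (forall x, S x -> (forall i, `|e i x| <= b i) -> phi x <= rho) ->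
  exists2 w : 'I_N -> R, forall x, S x -> phi x = \sum_i w i * e i x &
    \sum_i `|w i| * b i <= rho.
Proof.
elim: N phi e b rho => [|N IH] phi e b rho phil el b0 H.
  have r0 : 0 <= rho by rewrite -(linear_form0 phil); apply: H => // -[].
  exists (fun=> 0); last by rewrite big_ord0.
  move=> x Sx; rewrite big_ord0; apply/eqP/negPn/negP => px0.
  have : phi (((rho + 1) / phi x) *: x) <= rho.
    by apply: H => [|[]//]; rewrite -[_ *: x]addr0; exact: SD.
  by rewrite linear_formZ// divfK// gerDl ler10.
pose e' i := e (lift ord0 i); pose b' i := b (lift ord0 i).
pose C := [set x | S x /\ forall i, `|e' i x| <= b' i].
suff [c Hc] : exists c, forall x, C x -> phi x - c * e ord0 x <= rho - `|c| * b ord0.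
  have pl : linear_form (fun x => phi x - c * e ord0 x).
    by move=> t x y; rewrite phil el; ring.
  have [||x Sx Hx|w wE wr] := IH _ e' b' (rho - `|c| * b ord0) pl.
  - by move=> i; exact: el.
  - by move=> i; exact: b0.
  - exact: Hc.
  exists (fun i => if unlift ord0 i is Some j then w j else c).
    move=> x Sx; rewrite big_ord_recl unlift_none; under eq_bigr do rewrite liftK.
    by rewrite -[\sum_(i < N) _]wE// addrC subrK.
  rewrite big_ord_recl unlift_none; under eq_bigr do rewrite liftK.
  by rewrite -lerBrDl.
have [C0|] := pselect (forall x, C x -> phi x <= rho).
  by exists 0 => x /C0; rewrite normr0 !mul0r !subr0.
move=> /existsNP[x1 /not_implyP[Cx1 /negP]]; rewrite -ltNge => rx1.
have CN x : C x -> C (- x).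
  move=> [Sx xb]; split=> [|i]; first by rewrite -[- x]addr0 -scaleN1r; exact: SD.
  by rewrite -scaleN1r linear_formZ ?mulN1r ?normrN//; exact: el.
have Cc (t : R) x y : 0 <= t <= 1 -> C x -> C y -> C (t *: x + (1 - t) *: y).
  move=> /andP[t0 t1] [Sx xb] [Sy yb]; split=> [|i].
    by apply: SD => //; rewrite -[_ *: y]addr0; exact: SD.
  rewrite /e' el linear_formZ//.
  apply: le_trans (ler_normD _ _) _; rewrite !normrM (ger0_norm t0).
  rewrite (ger0_norm (_ : 0 <= 1 - t)) ?subr_ge0//.
  have h1 : t * `|e (lift ord0 i) x| <= t * b' i.
    by rewrite ler_wpM2l//; exact: xb.
  have h2 : (1 - t) * `|e (lift ord0 i) y| <= (1 - t) * b' i.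
    by rewrite ler_wpM2l ?subr_ge0//; exact: yb.
  by apply: le_trans (lerD h1 h2) _; rewrite -mulrDl addrC subrK mul1r.
have Crho x : C x -> `|e ord0 x| <= b ord0 -> phi x <= rho.
  move=> [Sx xb] x0; apply: H => // i.
  by have [j ->|->] := unliftP ord0 i; [exact: xb | exact: x0].
have : ~~ (`|e ord0 x1| <= b ord0).
  by apply/negP => /(Crho _ Cx1); rewrite leNgt rx1.
(* Since [phi] exceeds [rho] at [x1], the first constraint fails there; the side on which it fails
   fixes the sign of the multiplier. *)
rewrite -ltNge ltr_normr => /orP[bx1|bx1].
  have [c c0 Hc] := supporting_slope phil (el ord0) (b0 ord0) CN Cc Crho Cx1 bx1 rx1.
  by exists c; rewrite ger0_norm.
have eNl : linear_form (fun x => - e ord0 x).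
  by move=> t x y; rewrite el; ring.
have CrhoN x : C x -> `|- e ord0 x| <= b ord0 -> phi x <= rho.
  by rewrite normrN; exact: Crho.
have [c c0 Hc] := supporting_slope phil eNl (b0 ord0) CN Cc CrhoN Cx1 bx1 rx1.
by exists (- c) => x /Hc; rewrite normrN ger0_norm// mulNr mulrN.
Qed.

End Duality.

(** * Taylor remainders *)

Section TaylorRemainder.
Context {R : realType}.

(** Monotonicity stands in for integration: the primitive of A x^beta, plus or minus [v], has a
    nonnegative derivative. The power is differentiated at positive points only, so the comparison
    starts at a small [e > 0] and uses continuity of [v] at 0. *)
Lemma primitive_powR_bound (v dv : R -> R) (A beta : R) : 0 <= A -> 0 <= beta ->
  v 0 = 0 -> (forall t : R, 0 <= t <= 1 -> is_derive t 1 v (dv t)) ->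
  (forall t, 0 <= t <= 1 -> `|dv t| <= A * t `^ beta) ->
  forall t, 0 <= t <= 1 -> `|v t| <= A / (beta + 1) * t `^ (beta + 1).
Proof.
move=> A0 beta0 v0 vd dvA t /andP[t0 t1]; have b1 : 0 < beta + 1 by rewrite ltr_wpDl.
have [->|tn0] := eqVneq t 0.
  by rewrite v0 normr0 mulr_ge0 ?powR_ge0// divr_ge0// ltW.
have {t0}tp : 0 < t by rewrite lt_def tn0.
have key (sg : R) : `|sg| = 1 -> 0 <= A / (beta + 1) * t `^ (beta + 1) - sg * v t.
  move=> sg1; pose g x := A / (beta + 1) * x `^ (beta + 1) - sg * v x.
  have gd x : 0 < x -> x <= t -> is_derive x 1 g (A * x `^ beta - sg * dv x).
    move=> x0 xt.
    have D1 := is_derive1_powR (beta + 1) x0.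
    have x01 : 0 <= x <= 1 by rewrite ltW//= (le_trans xt).
    have D : is_derive x 1 g _ :=
      is_deriveB (is_deriveZ (A / (beta + 1)) D1) (is_deriveZ sg (vd _ x01)).
    apply: (is_derive_eq D); rewrite /GRing.scale/= addrK mulrA; congr (_ * _ - _).
    by field; rewrite gt_eqF.
  have gmono e : 0 < e -> e < t -> g e <= g t.
    move=> e0 et; rewrite -subr_ge0.
    have [||x xet ->] := @MVT _ g (fun x => A * x `^ beta - sg * dv x) e t et.
    - move=> x; rewrite in_itv/= => /andP[ex xt]; apply: gd; last exact: ltW.
      exact: lt_trans ex.
    - apply: derivable_within_continuous => x; rewrite in_itv/= => /andP[ex xt].
      by have [] := gd x (lt_le_trans e0 ex) xt.
    - move: xet; rewrite in_itv/= => /andP[ex xt].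
      rewrite mulr_ge0 ?subr_ge0//; last exact: ltW.
      have x01 : 0 <= x <= 1 by rewrite (ltW (lt_trans e0 ex))/= (le_trans (ltW xt)).
      by apply: le_trans (dvA x x01); rewrite (le_trans (ler_norm _))// normrM sg1 mul1r.
  rewrite -/(g t) leNgt; apply/negP => gt0.
  have v0c : {for 0, continuous v}.
    apply/differentiable_continuous/derivable1_diffP.
    by have [] := vd 0 _; rewrite ?lexx ?ler01.
  have /cvgrPdist_lt/(_ _ (_ : 0 < - g t)) := v0c; rewrite oppr_gt0 => /(_ gt0).
  rewrite v0 => /nbhs_ballP[del /= del0 H].
  pose e := Num.min (del / 2) (t / 2).
  have e0 : 0 < e by rewrite lt_min !divr_gt0.
  have et : e < t by rewrite gt_min (_ : t / 2 < t) ?orbT//; lra.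
  have ed : e < del by rewrite gt_min (_ : del / 2 < del)//; lra.
  have : `|0 - v e| < - g t.
    by apply: H; rewrite -ball_normE /= sub0r normrN gtr0_norm.
  rewrite sub0r normrN ltNge => /negP; apply.
  have h1 : sg * v e <= `|v e| by rewrite (le_trans (ler_norm _))// normrM sg1 mul1r.
  have h2 : 0 <= A / (beta + 1) * e `^ (beta + 1).
    by rewrite mulr_ge0 ?powR_ge0// divr_ge0// ltW.
  have := gmono e e0 et; rewrite {1}/g; lra.
have := key 1; rewrite normr1 mul1r subr_ge0 => /(_ erefl) h1.
have := key (-1); rewrite normrN1 mulN1r opprK => /(_ erefl) h2.
by rewrite ler_norml h1 andbT; lra.
Qed.

(** The derivative of the remainder is the remainder of lower order for the shifted family;
    integrating the exponent [beta + j - 1] contributes the factor [beta + j] of the denominator. *)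
Lemma taylor_bound m (g : nat -> R -> R) (A beta : R) : 0 <= A -> 0 <= beta ->
  (forall c (t : R), (c < m)%N -> 0 <= t <= 1 -> is_derive t 1 (g c) (g c.+1 t)) ->
  (forall t, 0 <= t <= 1 -> `|g m t - g m 0| <= A * t `^ beta) ->
  forall t, 0 <= t <= 1 ->
  `|g 0%N t - \sum_(c < m.+1) g c 0 / c`!%:R * t ^+ c| <=
    A / (\prod_(1 <= j < m.+1) (beta + j%:R)) * t `^ (beta + m%:R).
Proof.
move=> A0 beta0; elim: m g => [|m IH] g gd gA t t01.
  by rewrite big_ord1 big_geq// divr1 expr0 mulr1 divr1 addr0; exact: gA.
have prod_gt0 n : 0 < \prod_(1 <= j < n) (beta + j%:R).
  rewrite big_seq_cond; apply: prodr_gt0 => j.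
  by rewrite mem_index_iota andbT => /andP[j1 _]; rewrite ltr_wpDl// ltr0n.
pose P := \poly_(c < m.+2) (g c 0 / c`!%:R).
have PE u : P.[u] = \sum_(c < m.+2) g c 0 / c`!%:R * u ^+ c by rewrite horner_poly.
have dPE u : P^`().[u] = \sum_(c < m.+1) g c.+1 0 / c`!%:R * u ^+ c.
  have -> : P^`() = \poly_(c < m.+1) (g c.+1 0 / c`!%:R).
    apply/polyP => i; rewrite coef_deriv !coef_poly ltnS.
    case: ifP => [_|]; last by rewrite mul0rn.
    rewrite -[LHS]mulr_natr -mulrA; congr (_ * _); rewrite factS natrM invfM mulrAC.
    by rewrite mulVf ?mul1r// pnatr_eq0.
  by rewrite horner_poly.
rewrite -PE big_nat_recr//= -natr1 addrA invfM mulrA.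
apply: (@primitive_powR_bound (fun u => g 0%N u - P.[u]) (fun u => g 1%N u - P^`().[u])).
- by rewrite divr_ge0// ltW.
- by rewrite addr_ge0.
- rewrite PE big_ord_recl expr0 mulr1 fact0 divr1 big1 ?addr0 ?subrr// => i _.
  by rewrite expr0n mulr0.
- by move=> u u01; apply: is_deriveB; exact: gd.
- move=> u u01; rewrite dPE; apply: (IH (fun c => g c.+1)) => //.
  by move=> c u' cm; exact: gd.
- exact: t01.
Qed.

End TaylorRemainder.

Section TaylorRemainder2.
Context {R : realType}.

(* The Taylor remainder of order m in t of the Taylor remainder of order m in
   s; only the mixed second difference of the highest derivative enters. *)
Lemma taylor_bound2 m (u : nat -> nat -> R -> R -> R) (A beta : R) :
  0 <= A -> 0 <= beta ->
  (forall c e (t s : R), (c < m)%N -> (e <= m)%N -> 0 <= t <= 1 -> 0 <= s <= 1 ->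
    is_derive t 1 (fun t => u c e t s) (u c.+1 e t s)) ->
  (forall e (t s : R), (e < m)%N -> 0 <= t <= 1 -> 0 <= s <= 1 ->
    is_derive s 1 (u m e t) (u m e.+1 t s)) ->
  (forall t s : R, 0 <= t <= 1 -> 0 <= s <= 1 ->
    `|u m m t s - u m m t 0 - u m m 0 s + u m m 0 0| <= A * t `^ beta * s `^ beta) ->
  `|u 0%N 0%N 1 1 - \sum_(e < m.+1) u 0%N e 1 0 / e`!%:R
    - \sum_(c < m.+1) (u c 0%N 0 1 - \sum_(e < m.+1) u c e 0 0 / e`!%:R) / c`!%:R|
  <= A / (\prod_(1 <= j < m.+1) (beta + j%:R)) ^+ 2.
Proof.
move=> A0 beta0 ut us uA.
have i0 : 0 <= (0 : R) <= 1 by rewrite lexx ler01.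
have i1 : 0 <= (1 : R) <= 1 by rewrite lexx ler01.
set P := \prod_(_ <= _ < _) _.
have P0 : 0 < P.
  rewrite /P big_seq_cond; apply: prodr_gt0 => j.
  by rewrite mem_index_iota andbT => /andP[j1 _]; rewrite ltr_wpDl// ltr0n.
pose g c t := u c 0%N t 1 - \sum_(e < m.+1) u c e t 0 / e`!%:R.
have sumT (v : nat -> R -> R) : \sum_(c < m.+1) v c 0 / c`!%:R * 1 ^+ c =
    \sum_(c < m.+1) v c 0 / c`!%:R.
  by apply: eq_bigr => c _; rewrite expr1n mulr1.
have gd c (t : R) : (c < m)%N -> 0 <= t <= 1 -> is_derive t 1 (g c) (g c.+1 t).
  move=> cm t01; apply: is_deriveB; first exact: ut.
  have D : is_derive t 1 (\sum_(e < m.+1) (fun t => u c e t 0 / e`!%:R))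
      (\sum_(e < m.+1) u c.+1 e t 0 / e`!%:R).
    apply: is_derive_sum => e; rewrite mulrC.
    have -> : (fun t => u c e t 0 / e`!%:R) = e`!%:R^-1 \*: (fun t => u c e t 0).
      by apply/funext => z; rewrite /= mulrC.
    by apply: is_deriveZ; apply: ut => //; rewrite -ltnS.
  by move: D; rewrite fct_sumE.
have gA (t : R) : 0 <= t <= 1 -> `|g m t - g m 0| <= A / P * t `^ beta.
  (* At fixed [t] these increments form a Taylor family in [s], and the increment of its top member
     is the mixed second difference. *)
  move=> t01; pose v e s := u m e t s - u m e 0 s.
  have -> : g m t - g m 0 = v 0%N 1 - \sum_(e < m.+1) v e 0 / e`!%:R * 1 ^+ e.
    rewrite sumT /g /v; under [in RHS]eq_bigr do rewrite mulrBl.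
    by rewrite sumrB; ring.
  have := @taylor_bound R m v (A * t `^ beta) beta _ beta0 _ _ 1 i1.
  rewrite powR1 mulr1 mulrAC; apply.
  - by rewrite mulr_ge0// powR_ge0.
  - by move=> e s em s01; apply: is_deriveB; exact: us.
  - move=> s s01; apply: le_trans (uA t s t01 s01).
    by rewrite le_eqVlt; apply/orP; left; apply/eqP; congr `|_|; rewrite /v; ring.
have := @taylor_bound R m g (A / P) beta _ beta0 gd gA 1 i1.
rewrite powR1 mulr1 sumT -mulrA -invfM -expr2; apply.
by rewrite divr_ge0// ltW.
Qed.

End TaylorRemainder2.

(** * Iterated directional derivatives *)

Section DirectionalJets.
Context {R : realType} {d : nat}.
Implicit Types (h g x : 'rV[R]_d) (hs : seq 'rV[R]_d) (l : seq 'I_d) (T : seq 'I_d -> R).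

(* T stands for the family of partial derivatives of a function at a point;
   directions in hs are contracted against the indices consed onto l. *)
Fixpoint dirjet hs T l : R :=
  if hs is h :: hs' then \sum_(i < d) h 0 i * dirjet hs' T (i :: l) else T l.

Definition symmetric_jet n T :=
  forall l l', perm_eq l l' -> (size l <= n)%N -> T l = T l'.

Lemma dirjetB hs T T' l : dirjet hs T l - dirjet hs T' l =
  dirjet hs (fun l => T l - T' l) l.
Proof.
elim: hs l => //= h hs IH l; rewrite -sumrB; apply: eq_bigr => i _.
by rewrite -mulrBr IH.
Qed.

Lemma dirjet_sym n hs T : symmetric_jet n T ->
  forall l l', perm_eq l l' -> (size hs + size l <= n)%N ->
  dirjet hs T l = dirjet hs T l'.
Proof.
move=> Ts; elim: hs => [|h hs IH] l l' ll'; first exact: Ts.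
rewrite addSnnS => hl; apply: eq_bigr => i _; congr (_ * _).
by apply: IH => //; rewrite perm_cons.
Qed.

Lemma dirjet_swap n h g hs T l : symmetric_jet n T ->
  ((size hs + size l).+2 <= n)%N ->
  dirjet [:: h, g & hs] T l = dirjet [:: g, h & hs] T l.
Proof.
move=> Ts hl /=; under eq_bigr do rewrite mulr_sumr.
rewrite exchange_big; apply: eq_bigr => i _; rewrite mulr_sumr.
apply: eq_bigr => j _; rewrite mulrCA; congr (_ * (_ * _)).
apply: (dirjet_sym Ts); last by rewrite /= !addnS.
by rewrite -[[:: i, j & l]]cat1s -[[:: j, i & l]]cat1s -[j :: l]cat1s -[i :: l]cat1s perm_catCA.
Qed.

Lemma dirjet_cons_cat n h hs1 hs2 T l : symmetric_jet n T ->
  (size (hs1 ++ h :: hs2) + size l <= n)%N ->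
  dirjet (h :: hs1 ++ hs2) T l = dirjet (hs1 ++ h :: hs2) T l.
Proof.
move=> Ts; elim: hs1 l => [//|g hs1 IH] l /=; rewrite addSn => hl.
rewrite -[LHS]/(dirjet [:: h, g & hs1 ++ hs2] T l) (dirjet_swap _ _ Ts); last first.
  by move: hl; rewrite !size_cat /= addnS addSn.
by apply: eq_bigr => i _; congr (_ * _); apply: IH; rewrite /= addnS.
Qed.

Definition l1norm h : R := \sum_(i < d) `|h 0 i|.

Lemma l1norm_ge0 h : 0 <= l1norm h.
Proof. exact: sumr_ge0. Qed.

Lemma dirjet_bound n hs T l (B : R) : (forall l', size l' = n -> `|T l'| <= B) ->
  (size hs + size l = n)%N ->
  `|dirjet hs T l| <= (\prod_(h <- hs) l1norm h) * B.
Proof.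
move=> TB; elim: hs l => [|h hs IH] l hl; first by rewrite big_nil mul1r; exact: TB.
rewrite big_cons /= (le_trans (ler_norm_sum _ _ _))//.
rewrite /l1norm -mulrA mulr_suml; apply: ler_sum => i _.
by rewrite normrM ler_wpM2l// IH// /= addnS.
Qed.

Lemma is_derive_dirjet r (U : set 'rV[R]_d) (f : 'rV[R]_d -> R) hs l x h (t : R) :
  open U -> Cr_open r f U -> (size hs + size l < r)%N -> U (x + t *: h) ->
  is_derive t 1 (fun t => dirjet hs (fun l => partials l f (x + t *: h)) l)
    (dirjet (h :: hs) (fun l => partials l f (x + t *: h)) l).
Proof.
move=> oU Cf; elim: hs l => [|g hs IH] l hl Ux.
  exact: (is_derive_partials_line oU Cf).
have Ts : symmetric_jet r (fun l => partials l f (x + t *: h)).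
  by move=> l1 l2 l12 l1r; exact: (partials_perm oU Cf).
(* The new direction [h] is moved below [g], where the induction hypothesis produces it. *)
rewrite (dirjet_swap _ _ Ts); last by move: hl; rewrite /= addSn.
have D : is_derive t 1 (\sum_(i < d)
    (fun t => g 0 i * dirjet hs (fun l => partials l f (x + t *: h)) (i :: l)))
    (\sum_(i < d) g 0 i *
      dirjet (h :: hs) (fun l => partials l f (x + t *: h)) (i :: l)).
  apply: is_derive_sum => i; apply: is_deriveZ.
  by apply: IH => //; move: hl; rewrite /= addnS addSn.
by move: D; rewrite fct_sumE.
Qed.

End DirectionalJets.

(** * Euclidean norm and geometric means *)

Section Enorm.
Context {R : realType} {d : nat}.
Implicit Types (x y : 'rV[R]_d).

Lemma enorm_ge0 x : 0 <= enorm x.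
Proof. exact: sqrtr_ge0. Qed.

Lemma enormZ (a : R) x : enorm (a *: x) = `|a| * enorm x.
Proof.
rewrite /enorm -sqrtr_sqr -sqrtrM ?sqr_ge0// mulr_sumr; congr Num.sqrt.
by apply: eq_bigr => i _; rewrite mxE exprMn.
Qed.

Lemma enormN x : enorm (- x) = enorm x.
Proof. by rewrite -scaleN1r enormZ normrN1 mul1r. Qed.

(** Cauchy-Schwarz with the all-ones vector, read off the discriminant of sum_i (1 + t |x_i|)^2. *)
Lemma l1norm_enorm x : l1norm x <= Num.sqrt d%:R * enorm x.
Proof.
rewrite -sqrtrM ?ler0n// -(ger0_norm (l1norm_ge0 x)) -sqrtr_sqr ler_wsqrtr//.
apply: discriminant_le => [|t]; first by apply: sumr_ge0 => i _; exact: sqr_ge0.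
have -> : d%:R + 2 * t * l1norm x + t ^+ 2 * (\sum_(i < d) x 0 i ^+ 2) =
    \sum_(i < d) (1 + t * `|x 0 i|) ^+ 2.
  have dE : d%:R = \sum_(i < d) (1 : R) by rewrite sumr_const card_ord.
  rewrite dE /l1norm !mulr_sumr -!big_split/=.
  by apply: eq_bigr => i _; rewrite -[x 0 i ^+ 2]real_normK ?num_real//; ring.
by apply: sumr_ge0 => i _; exact: sqr_ge0.
Qed.

End Enorm.

Section GeometricMean.
Context {R : realType}.

Lemma ler_geometric_mean (x a b y : R) : 0 <= x -> 0 <= y -> x <= a -> x <= b ->
  a * b = y ^+ 2 -> x <= y.
Proof.
move=> x0 y0 xa xb aby; rewrite -(ler_pXn2r (n := 2)) ?nnegrE// -aby expr2.
by apply: ler_pM.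
Qed.

Lemma powR_half_sqr (x p : R) : (x `^ (p / 2)) ^+ 2 = x `^ p.
Proof. by rewrite -powR_mulrn ?powR_ge0// -powRrM divfK// pnatr_eq0. Qed.

Lemma ler_geom_even (x K P Q gamma : R) : 0 <= x -> 0 <= K -> 0 <= P -> 0 <= Q ->
  x <= K * P `^ gamma -> x <= K * Q `^ gamma ->
  x <= K * (P `^ (gamma / 2) * Q `^ (gamma / 2)).
Proof.
move=> x0 K0 P0 Q0 xP xQ; apply: (ler_geometric_mean x0 _ xP xQ).
  by rewrite !mulr_ge0 ?powR_ge0.
by rewrite -(powR_half_sqr P) -(powR_half_sqr Q); ring.
Qed.

(** One estimate is linear in [P] and Hoelder in [Q], the other the reverse; their product is a
    multiple of (P Q)^(1 + gamma). The even split lets the final double sum over the nodes factor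
    into a square. *)
Lemma ler_geom_odd (x K P Q gamma : R) : 0 < gamma ->
  0 <= x -> 0 <= K -> 0 <= P -> 0 <= Q ->
  x <= K * (P * Q `^ gamma) -> x <= K * (Q * P `^ gamma) ->
  x <= K * (P `^ ((1 + gamma) / 2) * Q `^ ((1 + gamma) / 2)).
Proof.
move=> g0 x0 K0 P0 Q0 xP xQ; apply: (ler_geometric_mean x0 _ xP xQ).
  by rewrite !mulr_ge0 ?powR_ge0.
have E z : 0 <= z -> (z `^ ((1 + gamma) / 2)) ^+ 2 = z * z `^ gamma.
  move=> z0; rewrite powR_half_sqr powRD ?powRr1//.
  by apply/implyP => /eqP; lra.
by rewrite !exprMn !E//; ring.
Qed.

End GeometricMean.

(** * Double Taylor remainder of the kernel *)

Section KernelRemainder.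
Context {R : realType} {d : nat}.
Variables (r : nat) (gamma : R) (U B : set 'rV[R]_d) (Phi : 'rV[R]_d -> R) (H : R).
Hypotheses (gamma_gt0 : 0 < gamma) (oU : open U) (CPhi : Cr_open r Phi U)
  (BU : B `<=` U) (H0 : 0 <= H)
  (PhiH : forall l x y, size l = r -> B x -> B y ->
     `|partials l Phi x - partials l Phi y| <= H * enorm (x - y) `^ gamma).
Variables h g : 'rV[R]_d.
Hypothesis hgB : forall t s : R, 0 <= t <= 1 -> 0 <= s <= 1 -> B (t *: h + s *: g).

Definition jets (f : 'rV[R]_d -> R) x := fun l : seq 'I_d => partials l f x.

Let J hs x := dirjet hs (jets Phi x) [::].
Let m := r./2.

Lemma J_holder hs x y : size hs = r -> B x -> B y ->
  `|J hs x - J hs y| <= (\prod_(k <- hs) l1norm k) * (H * enorm (x - y) `^ gamma).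
Proof.
move=> hsr Bx By; rewrite dirjetB; apply: (@dirjet_bound _ _ r) => [l lr|].
  exact: PhiH.
by rewrite addn0.
Qed.

Lemma is_derive_J hs x k (t : R) : (size hs < r)%N -> U (x + t *: k) ->
  is_derive t 1 (fun t => J hs (x + t *: k)) (J (k :: hs) (x + t *: k)).
Proof.
by move=> hsr Ux; apply: (is_derive_dirjet oU CPhi) => //; rewrite addn0.
Qed.

(* One derivative is left when r is odd: mean value theorem in t, then the
   Hoelder estimate in s. *)
Lemma J_diff2_odd hs k k' (t s : R) : (size hs).+1 = r ->
  (forall t s : R, 0 <= t <= 1 -> 0 <= s <= 1 -> B (t *: k + s *: k')) ->
  0 <= t <= 1 -> 0 <= s <= 1 ->
  `|J hs (t *: k + s *: k') - J hs (t *: k) - J hs (s *: k') + J hs 0| <=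
    (\prod_(v <- hs) l1norm v) * H * l1norm k * (t * (s * enorm k') `^ gamma).
Proof.
move=> hsr kB t01 s01; have /andP[t0 t1] := t01; have /andP[s0 s1] := s01.
have i0 : 0 <= (0 : R) <= 1 by rewrite lexx ler01.
pose w v := J hs (s *: k' + v *: k) - J hs (0 + v *: k).
pose dw v := J (k :: hs) (s *: k' + v *: k) - J (k :: hs) (0 + v *: k).
have B1 (v : R) : 0 <= v <= 1 -> B (s *: k' + v *: k) by move=> v01; rewrite addrC; exact: kB.
have B2 (v : R) : 0 <= v <= 1 -> B (0 + v *: k).
  by move=> v01; rewrite addrC -(scale0r k'); exact: kB.
have wd (v : R) : 0 <= v <= 1 -> is_derive v 1 w (dw v).
  by move=> v01; apply: is_deriveB; apply: is_derive_J;
    [rewrite -hsr | exact/BU/B1 | rewrite -hsr | exact/BU/B2].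
have [||v vt wE] := @MVT_segment _ w dw 0 t t0.
- move=> v; rewrite in_itv/= => /andP[v0 vt]; apply: wd.
  by rewrite ltW//= (le_trans (ltW vt)).
- apply: derivable_within_continuous => v; rewrite in_itv/= => /andP[v0 vt].
  by have [] := wd v _; rewrite ?v0 ?(le_trans vt).
have v01 : 0 <= v <= 1.
  by move: vt; rewrite in_itv/= => /andP[-> /le_trans]; apply.
have -> : J hs (t *: k + s *: k') - J hs (t *: k) - J hs (s *: k') + J hs 0 = w t - w 0.
  rewrite /w !scale0r !addr0 !add0r [s *: k' + _]addrC; ring.
rewrite wE subr0 normrM (ger0_norm t0).
have := J_holder (hs := k :: hs) hsr (B1 v v01) (B2 v v01); rewrite -/(dw v) big_cons.
rewrite add0r addrK enormZ (ger0_norm s0) => Hdw.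
apply: le_trans (ler_wpM2r t0 Hdw) _.
by rewrite le_eqVlt; apply/orP; left; apply/eqP; ring.
Qed.

Let a := enorm h.
Let b := enorm g.
Let D : R := Num.sqrt d%:R.
Let a0 : 0 <= a := enorm_ge0 h.
Let b0 : 0 <= b := enorm_ge0 g.
Let D0 : 0 <= D := sqrtr_ge0 _.

Lemma prod_l1norm_le : \prod_(v <- nseq m h ++ nseq m g) l1norm v <=
  D ^+ m.*2 * (a ^+ m * b ^+ m).
Proof.
rewrite big_cat/= !big_nseq !iter_mulr_1 -addnn exprD mulrACA -!exprMn.
apply: lerXn2r; rewrite ?nnegrE ?mulr_ge0 ?l1norm_ge0//.
by apply: ler_pM; rewrite ?l1norm_ge0//; exact: l1norm_enorm.
Qed.

Definition half_exponent : R := if odd r then (1 + gamma) / 2 else gamma / 2.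

(** For odd [r] the mean value theorem spends the one derivative left after [m] in each argument,
    and a single Hoelder increment remains; for even [r] two increments are added. *)
Definition second_difference_const : R := if odd r then D ^+ r else 2 * D ^+ r.

Lemma half_exponent_gt0 : 0 < half_exponent.
Proof. by rewrite /half_exponent; case: ifP => _; rewrite divr_gt0// addr_gt0. Qed.

Lemma half_exponentE : (r%:R + gamma) / 2 = m%:R + half_exponent.
Proof.
rewrite /half_exponent /m -{1}(odd_double_half r) natrD -mul2n natrM.
by case: (odd r) => /=; field.
Qed.

Let hs := nseq m h ++ nseq m g.

Lemma second_difference t s : 0 <= t <= 1 -> 0 <= s <= 1 ->
  `|J hs (t *: h + s *: g) - J hs (t *: h) - J hs (s *: g) + J hs 0| <=
    second_difference_const * H * a `^ ((r%:R + gamma) / 2) * b `^ ((r%:R + gamma) / 2)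
    * t `^ half_exponent * s `^ half_exponent.
Proof.
move=> t01 s01; set X := `|_|.
have /andP[t0 _] := t01; have /andP[s0 _] := s01.
have i0 : 0 <= (0 : R) <= 1 by rewrite lexx ler01.
have ta : 0 <= t * a by rewrite mulr_ge0.
have sb : 0 <= s * b by rewrite mulr_ge0.
have hs2 : size hs = m.*2 by rewrite size_cat !size_nseq addnn.
have powE z : 0 <= z -> z `^ ((r%:R + gamma) / 2) = z ^+ m * z `^ half_exponent.
  move=> z0; rewrite half_exponentE powRD; first by rewrite powR_mulrn.
  by rewrite gt_eqF// ltr_wpDl ?half_exponent_gt0.
suff : X <= second_difference_const * H * (a ^+ m * b ^+ m) *
    ((t * a) `^ half_exponent * (s * b) `^ half_exponent).
  move=> /le_trans; apply; rewrite !powE// !powRM//.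
  by rewrite le_eqVlt; apply/orP; left; apply/eqP; ring.
have Bts (u v : R) : 0 <= u <= 1 -> 0 <= v <= 1 -> B (u *: h + v *: g) by exact: hgB.
have Bt : B (t *: h) by rewrite -[_ *: h]addr0 -(scale0r g); exact: hgB.
have Bs : B (s *: g) by rewrite -[_ *: g]add0r -(scale0r h); exact: hgB.
have BB0 : B 0 by rewrite -[0]addr0 -{1}(scale0r h) -(scale0r g); exact: hgB.
have L0 : 0 <= \prod_(v <- hs) l1norm v.
  by rewrite big_seq; apply: prodr_ge0 => v _; exact: l1norm_ge0.
have LP := prod_l1norm_le; rewrite -/hs in LP.
rewrite /second_difference_const /half_exponent.
have [rodd|reven] := boolP (odd r).
- have rE : r = m.*2.+1 by rewrite -[LHS]odd_double_half rodd.
  have hs1 : (size hs).+1 = r by rewrite hs2 -rE.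
  have lift (k : 'rV[R]_d) z y : 0 <= z -> 0 <= y ->
      (\prod_(v <- hs) l1norm v) * H * l1norm k * (z * y) <=
      D ^+ r * H * (a ^+ m * b ^+ m) * (z * enorm k * y).
    move=> z0 y0.
    have -> : D ^+ r * H * (a ^+ m * b ^+ m) * (z * enorm k * y) =
      D ^+ m.*2 * (a ^+ m * b ^+ m) * H * (D * enorm k) * (z * y).
      by rewrite rE exprS; ring.
    apply: ler_wpM2r; first exact: mulr_ge0.
    apply: ler_pM; rewrite ?mulr_ge0 ?l1norm_ge0//; last exact: l1norm_enorm.
    exact: ler_wpM2r.
  (* The first estimate uses the mean value theorem along [h] and the Hoelder condition along [g],
     the second exchanges the two directions. *)
  apply: (ler_geom_odd gamma_gt0 (normr_ge0 _) _ ta sb); first by rewrite !mulr_ge0 ?exprn_ge0.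
    apply: le_trans (lift h t ((s * b) `^ gamma) t0 (powR_ge0 _ _)).
    exact: (J_diff2_odd hs1 Bts t01 s01).
  apply: le_trans (lift g s ((t * a) `^ gamma) s0 (powR_ge0 _ _)).
  have Bst (u v : R) : 0 <= u <= 1 -> 0 <= v <= 1 -> B (u *: g + v *: h).
    by move=> u01 v01; rewrite addrC; exact: hgB.
  apply: le_trans (J_diff2_odd hs1 Bst s01 t01).
  rewrite /X [s *: g + _]addrC le_eqVlt; apply/orP; left; apply/eqP; congr `|_|; ring.
- have rE : r = m.*2 by rewrite -[LHS]odd_double_half (negbTE reven).
  have hs1 : size hs = r by rewrite hs2 -rE.
  have lift (y : R) : 0 <= y ->
      2 * ((\prod_(v <- hs) l1norm v) * (H * y)) <=
      2 * D ^+ r * H * (a ^+ m * b ^+ m) * y.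
    move=> y0; rewrite -!mulrA ler_wpM2l//.
    have -> : D ^+ r * (H * (a ^+ m * (b ^+ m * y))) = D ^+ m.*2 * (a ^+ m * b ^+ m) * (H * y).
      by rewrite -rE; ring.
    by apply: ler_wpM2r => //; exact: mulr_ge0.
  (* The four points are paired in two ways, with differences [t *: h] or [s *: g]; each pairing
     gives one of the two estimates. *)
  have JJ x y x' y' (k : 'rV[R]_d) z : B x -> B y -> B x' -> B y' -> 0 <= z ->
      x - y = z *: k -> x' - y' = z *: k ->
      `|(J hs x - J hs y) - (J hs x' - J hs y')| <=
      2 * ((\prod_(v <- hs) l1norm v) * (H * (z * enorm k) `^ gamma)).
    move=> Bx By Bx' By' z0 xy x'y'; apply: le_trans (ler_normB _ _) _.
    have := J_holder hs1 Bx By; have := J_holder hs1 Bx' By'.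
    by rewrite xy x'y' enormZ (ger0_norm z0) => h1 h2; lra.
  apply: (ler_geom_even (normr_ge0 _) _ ta sb); first by rewrite !mulr_ge0 ?exprn_ge0.
    apply: le_trans (lift ((t * a) `^ gamma) (powR_ge0 _ _)).
    have := JJ _ _ _ _ h t (Bts t s t01 s01) Bs Bt BB0 t0.
    rewrite addrK subr0 => /(_ erefl erefl); apply: le_trans.
    rewrite /X le_eqVlt; apply/orP; left; apply/eqP; congr `|_|; ring.
  apply: le_trans (lift ((s * b) `^ gamma) (powR_ge0 _ _)).
  have := JJ _ _ _ _ g s (Bts t s t01 s01) Bt Bs BB0 s0.
  rewrite addrC addKr subr0 => /(_ erefl erefl); apply: le_trans.
  rewrite /X le_eqVlt; apply/orP; left; apply/eqP; congr `|_|; ring.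
Qed.


Lemma C_constE : C_const d r gamma =
  second_difference_const / (\prod_(1 <= j < m.+1) (half_exponent + j%:R)) ^+ 2.
Proof.
have DE : D ^+ r = d%:R `^ (r%:R / 2).
  by rewrite /D -powR12_sqrt ?ler0n// -powR_mulrn ?powR_ge0// -powRrM mulrC.
rewrite /C_const /second_difference_const /half_exponent /m -prodrXl DE.
by case: ifP.
Qed.

Lemma kernel_remainder :
  `|Phi (h + g) - \sum_(e < m.+1) dirjet (nseq e g) (jets Phi h) [::] / e`!%:R
    - \sum_(c < m.+1) (dirjet (nseq c h) (jets Phi g) [::]
       - \sum_(e < m.+1) dirjet (nseq c h ++ nseq e g) (jets Phi 0) [::] / e`!%:R)
       / c`!%:R|
  <= C_const d r gamma * H * a `^ ((r%:R + gamma) / 2) * b `^ ((r%:R + gamma) / 2).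
Proof.
pose u c e (t s : R) := J (nseq c h ++ nseq e g) (t *: h + s *: g).
set A := second_difference_const * H * a `^ ((r%:R + gamma) / 2) * b `^ ((r%:R + gamma) / 2).
have mr : (m.*2 <= r)%N by rewrite -[r in leqRHS]odd_double_half leq_addl.
have sizeJ c e : size (nseq c h ++ nseq e g) = (c + e)%N by rewrite size_cat !size_nseq.
have A0 : 0 <= A.
  rewrite !mulr_ge0 ?powR_ge0// /second_difference_const.
  by case: ifP => _; rewrite ?mulr_ge0 ?exprn_ge0.
have ut c e (t s : R) : (c < m)%N -> (e <= m)%N -> 0 <= t <= 1 -> 0 <= s <= 1 ->
    is_derive t 1 (fun t => u c e t s) (u c.+1 e t s).
  move=> cm em t01 s01.
  have -> : (fun t => u c e t s) = (fun t => J (nseq c h ++ nseq e g) (s *: g + t *: h)).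
    by apply/funext => z; rewrite /u addrC.
  rewrite /u addrC; apply: (@is_derive_J (nseq c h ++ nseq e g)).
    by rewrite sizeJ (leq_trans _ mr)// -addnn -addSn leq_add.
  by apply: BU; rewrite addrC; exact: hgB.
have us e (t s : R) : (e < m)%N -> 0 <= t <= 1 -> 0 <= s <= 1 ->
    is_derive s 1 (u m e t) (u m e.+1 t s).
  move=> em t01 s01.
  have Uts : U (t *: h + s *: g) by apply/BU/hgB.
  have lt_r : ((m + e).+1 <= r)%N by rewrite (leq_trans _ mr)// -addnn -addnS leq_add2l.
  (* Differentiation in [s] puts [g] at the head of the list, while [u] keeps it behind the copies
     of [h]. *)
  have -> : u m e.+1 t s = J (g :: nseq m h ++ nseq e g) (t *: h + s *: g).
    rewrite /u /J /= -(dirjet_cons_cat (n := r)) //.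
      by move=> l l' ll' lr; exact: (partials_perm oU CPhi).
    by rewrite addn0 size_cat /= !size_nseq addnS.
  by apply: is_derive_J => //; rewrite sizeJ.
have uA (t s : R) : 0 <= t <= 1 -> 0 <= s <= 1 ->
    `|u m m t s - u m m t 0 - u m m 0 s + u m m 0 0| <=
    A * t `^ half_exponent * s `^ half_exponent.
  move=> t01 s01; rewrite /u !scale0r !addr0 !add0r.
  exact: second_difference.
have := taylor_bound2 A0 (ltW half_exponent_gt0) ut us uA.
rewrite {1}/u /= !scale1r.
have -> : \sum_(e < m.+1) u 0%N e 1 0 / e`!%:R =
    \sum_(e < m.+1) dirjet (nseq e g) (jets Phi h) [::] / e`!%:R.
  by apply: eq_bigr => e _; rewrite /u scale1r scale0r addr0.
have -> : \sum_(c < m.+1) (u c 0%N 0 1 - \sum_(e < m.+1) u c e 0 0 / e`!%:R) / c`!%:R =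
    \sum_(c < m.+1) (dirjet (nseq c h) (jets Phi g) [::]
       - \sum_(e < m.+1) dirjet (nseq c h ++ nseq e g) (jets Phi 0) [::] / e`!%:R)
       / c`!%:R.
  apply: eq_bigr => c _; rewrite /u /= cats0 scale1r scale0r add0r.
  by congr ((_ - _) / _); apply: eq_bigr => e _; rewrite scale0r addr0.
move=> /le_trans; apply; rewrite C_constE /A.
by rewrite le_eqVlt; apply/orP; left; apply/eqP; ring.
Qed.

End KernelRemainder.

(** * The error functional *)

Section TaylorPolynomial.
Context {R : realType} {d : nat}.
Implicit Types (h x z : 'rV[R]_d) (l : seq 'I_d) (T : seq 'I_d -> R).

(* The homogeneous part of degree c of the Taylor polynomial at z of a function
   whose partial derivatives at z, after differentiation by l, are given by T. *)
Fixpoint taylor_part z c T l : mpoly d R :=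
  if c is c'.+1 then c%:R^-1 *: \sum_(i < d)
    (mpolyX R (mnm1 i) - mpolyC d (z 0 i)) * taylor_part z c' T (i :: l)
  else mpolyC d (T l).

Lemma peval_taylor_part z c T l h :
  peval (taylor_part z c T l) (z + h) = dirjet (nseq c h) T l / c`!%:R.
Proof.
elim: c l => [|c IH] l; first by rewrite /= /peval mevalC fact0 divr1.
rewrite /= pevalZ peval_sum factS natrM invfM mulrCA; congr (_ * _).
rewrite mulr_suml; apply: eq_bigr => i _.
have -> : h 0 i = (z + h) 0 i - z 0 i by rewrite mxE addrC addKr.
by rewrite {1}/peval mevalM mevalB mevalXU mevalC -/(peval _ _) IH mulrA.
Qed.

Lemma taylor_part_sym n z c T l l' : symmetric_jet n T -> perm_eq l l' ->
  (c + size l <= n)%N -> taylor_part z c T l = taylor_part z c T l'.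
Proof.
move=> Ts; elim: c l l' => [|c IH] l l' ll' cn /=; first by rewrite (Ts l l').
congr (_ *: _); apply: eq_bigr => i _; congr (_ * _).
by apply: IH; rewrite ?perm_cons//= addnS.
Qed.

Lemma mderiv_taylor_part n z c T l j : symmetric_jet n T -> (c.+1 + size l <= n)%N ->
  mderiv j (taylor_part z c.+1 T l) = taylor_part z c T (j :: l).
Proof.
move=> Ts; elim: c l => [|c IH] l cn.
  rewrite /= invr1 scale1r raddf_sum (bigD1 j)//= big1 ?addr0 => [|i ij].
    rewrite mderivM mderivB !mderivC subr0 mulr0 addr0 mderivX mnm1E eqxx scale1r.
    suff -> : mnm_sub (mnm1 j) (mnm1 j) = mnm0 by rewrite mpolyX0 mul1r.
    by apply/mnmP => a; rewrite mnmBE subnn mnm0E.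
  rewrite mderivM mderivB !mderivC subr0 mulr0 addr0 mderivX mnm1E (negbTE ij).
  by rewrite scale0r mul0r.
have -> : taylor_part z c.+2 T l = c.+2%:R^-1 *: \sum_(i < d)
    (mpolyX R (mnm1 i) - mpolyC d (z 0 i)) * taylor_part z c.+1 T (i :: l) by [].
rewrite mderivZ.
have E i : mderiv j ((mpolyX R (mnm1 i) - mpolyC d (z 0 i)) * taylor_part z c.+1 T (i :: l)) =
    (if i == j then taylor_part z c.+1 T (j :: l) else 0) +
    (mpolyX R (mnm1 i) - mpolyC d (z 0 i)) * taylor_part z c T [:: i, j & l].
  rewrite mderivM IH; last by rewrite /= addnS -addSn.
  congr (_ + _ * _); last first.
    apply: (taylor_part_sym _ Ts); last by move: cn; rewrite /= !addnS !addSn.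
    by rewrite -[[:: i, j & l]]cat1s -[[:: j, i & l]]cat1s -[j :: l]cat1s -[i :: l]cat1s perm_catCA.
  rewrite mderivB mderivC subr0 mderivX mnm1E.
  have [->|ij] := eqVneq i j; last by rewrite scale0r mul0r.
  suff -> : mnm_sub (mnm1 j) (mnm1 j) = mnm0 by rewrite mpolyX0 scale1r mul1r.
  by apply/mnmP => a; rewrite mnmBE subnn mnm0E.
have [q qE] : exists q, q = taylor_part z c.+1 T (j :: l) by eexists.
rewrite (_ : mderiv j _ = \sum_(i < d) ((if i == j then q else 0) +
    (mpolyX R (mnm1 i) - mpolyC d (z 0 i)) * taylor_part z c T [:: i, j & l])).
  2: by rewrite raddf_sum qE; apply: eq_bigr => i _; exact: E.
rewrite big_split/= -big_mkcond big_pred1_eq.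
(* Euler's identity for the homogeneous polynomial [q] in x - z, which is the recursion for
   [taylor_part] read backwards. *)
have -> : \sum_(i < d) (mpolyX R (mnm1 i) - mpolyC d (z 0 i)) * taylor_part z c T [:: i, j & l] =
    c.+1%:R *: q.
  by rewrite qE /= scalerA divff ?scale1r// pnatr_eq0.
have -> : q + c.+1%:R *: q = c.+2%:R *: q.
  by rewrite -[c.+2%:R]natr1 scalerDl scale1r addrC.
by rewrite !scalerA !mulVf ?scale1r// pnatr_eq0.
Qed.

Lemma msize_taylor_part z c T l : (msize (taylor_part z c T l) <= c.+1)%N.
Proof.
elim: c l => [|c IH] l /=; first by rewrite msizeC; case: (_ == _).
apply: leq_trans (msizeZ_le _ _) _.
elim/big_ind: _ => [|p q ps qs|i _]; first by rewrite mmeasure0.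
  by rewrite (leq_trans (msizeD_le _ _))// geq_max ps.
set p := _ - _; set q := taylor_part _ _ _ _.
have [->|p0] := eqVneq p 0; first by rewrite mul0r mmeasure0.
have [->|q0] := eqVneq q 0; first by rewrite mulr0 mmeasure0.
have p2 : (msize p <= 2)%N.
  rewrite (leq_trans (msizeD_le _ _))// msizeN msizeC msizeX mdeg1 geq_max.
  by case: (_ == _).
by rewrite msizeM// -subn1 leq_subLR add1n (leq_trans (leq_add p2 (IH (i :: l)))).
Qed.

Lemma mderivs_taylor_part n z c T l l0 : symmetric_jet n T -> (c + size l0 <= n)%N ->
  mderivs l (taylor_part z c T l0) =
  if (size l <= c)%N then taylor_part z (c - size l) T (l ++ l0) else 0.
Proof.
move=> Ts cn; elim: l => [|i l IH] /=; first by rewrite subn0.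
rewrite -/(mderivs l _) IH; have [lc|lc] := ltnP (size l) c.
  rewrite (ltnW lc) subnS; have : (0 < c - size l)%N by rewrite subn_gt0.
  case E : (c - size l)%N => [//|c'] _ /=.
  apply: (mderiv_taylor_part _ _ Ts); rewrite -E size_cat addnA subnK//.
  exact: ltnW.
have [lc'|lc'] := leqP (size l) c; last by rewrite mderiv0.
by rewrite (_ : (c - size l)%N = 0%N) ?mderivC//; apply/eqP; rewrite subn_eq0.
Qed.

Definition taylor_poly z m T : mpoly d R :=
  \sum_(c < m.+1) taylor_part z c T [::].

Lemma Pi_taylor_poly z m T : Pi_poly m.+1 (taylor_poly z m T).
Proof.
apply: Pi_poly_sum => c; apply: leq_trans (msize_taylor_part _ _ _ _) _.
exact: ltn_ord.
Qed.

Lemma peval_taylor_poly z m T h : peval (taylor_poly z m T) (z + h) =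
  \sum_(c < m.+1) dirjet (nseq c h) T [::] / c`!%:R.
Proof. by rewrite peval_sum; apply: eq_bigr => c _; exact: peval_taylor_part. Qed.

(** Only the part of degree [size l] survives: lower degrees are differentiated to 0, and higher
    ones still vanish at [z]. *)
Lemma pjet_taylor_poly z m T l : symmetric_jet m T -> (size l <= m)%N ->
  peval (mderivs l (taylor_poly z m T)) z = T l.
Proof.
move=> Ts lm.
have -> : mderivs l (taylor_poly z m T) = \sum_(c < m.+1) mderivs l (taylor_part z c T [::]).
  rewrite /taylor_poly; elim: l {lm} => //= i l IH.
  by rewrite -/(mderivs l _) IH raddf_sum.
rewrite peval_sum.
have E (c : 'I_m.+1) : peval (mderivs l (taylor_part z c T [::])) z =
    if (c : nat) == size l then T l else 0.
  rewrite (mderivs_taylor_part _ _ Ts); last by rewrite addn0 -ltnS.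
  rewrite cats0; have [lc|lc|lc] := ltngtP (size l) c.
  - rewrite -[X in peval _ X]addr0 peval_taylor_part.
    case E : (c - size l)%N => [|c'].
      by move: lc; rewrite -subn_gt0 E.
    by rewrite /= big1 ?mul0r// => i _; rewrite mxE mul0r.
  - by rewrite /peval meval0.
  - by rewrite lc subnn /= /peval mevalC.
under eq_bigr do rewrite E.
by rewrite -big_mkcond (big_pred1 (Ordinal (lm : (size l < m.+1)%N))).
Qed.

End TaylorPolynomial.

Section Multiindices.
Context {R : realType} {d : nat}.

Definition mlist (alpha : multinom d) : seq 'I_d :=
  flatten [seq nseq (alpha i) i | i <- enum 'I_d].

Lemma size_mlist alpha : size (mlist alpha) = mdeg alpha.
Proof.
rewrite /mlist size_flatten /shape -map_comp sumnE big_map mdegE big_enum.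
by apply: eq_bigr => i _; rewrite /= size_nseq.
Qed.

Lemma perm_mlist (l : seq 'I_d) : perm_eq (mlist (Multinom [tuple count_mem i l | i < d])) l.
Proof.
apply/allP => j _ /=; apply/eqP; rewrite /mlist count_flatten -map_comp sumnE big_map.
rewrite big_enum (bigD1 j)//= big1 ?addn0 => [|i ij].
  rewrite count_nseq /= eqxx mul1n.
  by rewrite -[LHS]/(fun_of_multinom _ _) /fun_of_multinom tnth_mktuple.
by rewrite count_nseq /= (negbTE ij).
Qed.

End Multiindices.

Section ErrorFunctional.
Context {R : realType} {d : nat}.
Notation feat := (seq 'I_d * 'rV[R]_d)%type.
Variables (k : nat) (a : multinom d -> 'rV[R]_d -> R) (z : 'rV[R]_d)
  (N : nat) (X : 'I_N -> 'rV[R]_d).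
Implicit Types (w : 'I_N -> R) (F : feat -> R).

Definition derivative_part : seq (R * feat) :=
  [seq (a alpha z, (mlist alpha, z)) | alpha : bmultinom d k.+1].

Definition nodal_part w : seq (R * feat) :=
  [seq (w j, ([::], X j)) | j : 'I_N].

Definition error_functional w : seq (R * feat) :=
  derivative_part ++ lscale (-1) (nodal_part w).

Lemma lapp_derivative_part F : lapp derivative_part F =
  \sum_(alpha : bmultinom d k.+1) a alpha z * F (mlist alpha, z).
Proof. by rewrite /lapp big_image. Qed.

Lemma lapp_nodal_part w F : lapp (nodal_part w) F = \sum_j w j * F ([::], X j).
Proof. by rewrite /lapp big_image. Qed.

Lemma lapp_error_functional w F : lapp (error_functional w) F =
  lapp derivative_part F - \sum_j w j * F ([::], X j).
Proof. by rewrite lapp_cat lapp_scale lapp_nodal_part mulN1r. Qed.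

Lemma mem_error_functional w (t : R * feat) : t \in error_functional w ->
  ((size t.2.1 <= k)%N /\ t.2.2 = z) \/ (t.2.1 = [::] /\ exists j, t.2.2 = X j).
Proof.
rewrite /error_functional mem_cat => /orP[] /mapP[u].
  by move=> _ ->; left; split => //=; rewrite size_mlist -ltnS; exact: bmdeg.
by move=> /mapP[j _ ->] ->; right; split => //; exists j.
Qed.

Lemma diffop_jet f : diffop k a f z = lapp derivative_part (jet f).
Proof. by rewrite lapp_derivative_part. Qed.

Lemma diffop_peval p : diffop k a (peval p) z = lapp derivative_part (pjet p).
Proof.
rewrite lapp_derivative_part; apply: eq_bigr => alpha _; congr (_ * _).
by rewrite /mpartial partials_peval.
Qed.

Lemma linear_diffop_peval : linear_form (fun p => diffop k a (peval p) z).
Proof.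
move=> c p q; rewrite !diffop_peval -lapp_fZ -lapp_fD; apply: eq_lapp => t _.
by rewrite /pjet mderivs_linear pevalD pevalZ.
Qed.

Lemma error_functional_pjet s w p : exact_weight s k a z X w -> Pi_poly s p ->
  lapp (error_functional w) (pjet p) = 0.
Proof.
move=> ew ps; rewrite lapp_error_functional -diffop_peval -ew//.
by apply/eqP; rewrite subr_eq0.
Qed.

Variable m : nat.
Hypothesis km : (k <= m)%N.

Definition taylor_jet F h : R :=
  \sum_(c < m.+1) dirjet (nseq c h) (fun l => F (l, z)) [::] / c`!%:R.

(* Exactness on polynomials of degree m lets the derivative part act on any jet
   through its Taylor expansions at the nodes. *)
Lemma error_functional_taylor s w F : (m < s)%N -> exact_weight s k a z X w ->
  symmetric_jet m (fun l => F (l, z)) ->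
  lapp (error_functional w) F =
  \sum_j w j * (taylor_jet F (X j - z) - F ([::], X j)).
Proof.
move=> ms ew Fs; rewrite lapp_error_functional.
under [RHS]eq_bigr do rewrite mulrBr.
rewrite sumrB; congr (_ - _).
set p := taylor_poly z m (fun l => F (l, z)).
have ps : Pi_poly s p by apply: leq_trans ms; exact: Pi_taylor_poly.
transitivity (diffop k a (peval p) z).
  rewrite diffop_peval !lapp_derivative_part; apply: eq_bigr => alpha _.
  congr (_ * _); rewrite /pjet /= /p pjet_taylor_poly// size_mlist.
  by apply: leq_trans km; rewrite -ltnS; exact: bmdeg.
rewrite -ew//; apply: eq_bigr => j _; congr (_ * _).
by rewrite -{1}(subrK z (X j)) addrC peval_taylor_poly.
Qed.

End ErrorFunctional.

Section DirjetAlgebra.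
Context {R : realType} {d : nat}.
Implicit Types (hs : seq 'rV[R]_d) (l : seq 'I_d) (T : seq 'I_d -> R).

Lemma eq_dirjet hs T T' l :
  (forall l', size l' = (size hs + size l)%N -> T l' = T' l') ->
  dirjet hs T l = dirjet hs T' l.
Proof.
elim: hs l => [|h hs IH] l TT' /=; first exact: TT'.
apply: eq_bigr => i _; congr (_ * _); apply: IH => l' l'E; apply: TT'.
by rewrite l'E /= addnS addSn.
Qed.

Lemma dirjet_sum n hs (F : nat -> seq 'I_d -> R) (b : nat -> R) l :
  dirjet hs (fun l => \sum_(e < n) F e l / b e) l =
  \sum_(e < n) dirjet hs (F e) l / b e.
Proof.
elim: hs l => //= h hs IH l.
under eq_bigr do rewrite IH mulr_sumr; rewrite exchange_big.
by apply: eq_bigr => e _; rewrite mulr_suml; apply: eq_bigr => i _; rewrite mulrA.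
Qed.

Lemma dirjet_cat hs1 hs2 T l :
  dirjet (hs1 ++ hs2) T l = dirjet hs1 (fun l => dirjet hs2 T l) l.
Proof. by elim: hs1 l => //= h hs1 IH l; apply: eq_bigr => i _; rewrite IH. Qed.

(** Each contracted index carries one sign, which is moved into its direction. Derivatives of Phi(x
    - y) in [y] along [X j - z] thus become derivatives of [Phi] along [z - X j]. *)
Lemma dirjet_signed hs T l : dirjet hs (fun l => (-1) ^+ size l * T l) l =
  (-1) ^+ size l * dirjet (map -%R hs) T l.
Proof.
elim: hs l => //= h hs IH l; rewrite mulr_sumr; apply: eq_bigr => i _.
by rewrite IH /= !mxE exprS; ring.
Qed.

Lemma dirjet_shift n hs T l l2 : symmetric_jet n T ->
  (size hs + size l2 + size l <= n)%N ->
  dirjet hs (fun l' => T (l ++ l')) l2 = dirjet hs T (l2 ++ l).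
Proof.
move=> Ts; elim: hs l2 => [|h hs IH] l2 hl /=.
  by apply: Ts; [rewrite perm_catC | rewrite size_cat addnC].
by apply: eq_bigr => i _; rewrite IH//= addnS.
Qed.

End DirjetAlgebra.

(** * Quadratic form of the error functional *)

Section ErrorForm.
Context {R : realType} {d : nat}.
Notation feat := (seq 'I_d * 'rV[R]_d)%type.
Variables (k : nat) (a : multinom d -> 'rV[R]_d -> R) (z : 'rV[R]_d)
  (N : nat) (X : 'I_N -> 'rV[R]_d).
Variables (r : nat) (gamma : R) (U B : set 'rV[R]_d) (Phi : 'rV[R]_d -> R) (H : R).
Hypotheses (gamma_gt0 : 0 < gamma) (oU : open U) (CPhi : Cr_open r Phi U)
  (BU : B `<=` U) (H0 : 0 <= H)
  (PhiH : forall l x y, size l = r -> B x -> B y ->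
     `|partials l Phi x - partials l Phi y| <= H * enorm (x - y) `^ gamma)
  (k2r : (2 * k <= r)%N).
Hypothesis XB : forall i j (t s : R), 0 <= t <= 1 -> 0 <= s <= 1 ->
  B (t *: (X i - z) - s *: (X j - z)).

Let m := r./2.
Let km : (k <= m)%N. Proof. by rewrite /m -[k]doubleK half_leq// -mul2n. Qed.
Let mr : (m.*2 <= r)%N.
Proof. by rewrite -[r in leqRHS]odd_double_half leq_addl. Qed.

Hypothesis B0 : B 0.

Let XzB i : B (X i - z).
Proof.
have := @XB i i 1 0; rewrite scale1r scale0r subr0.
by apply; rewrite !(lexx, ler01).
Qed.

Let zXB i : B (z - X i).
Proof.
have := @XB i i 0 1; rewrite scale1r scale0r sub0r opprB.
by apply; rewrite !(lexx, ler01).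
Qed.

Lemma symmetric_kernelr (s : feat) : (size s.1 <= m)%N -> U (s.2 - z) ->
  symmetric_jet m (fun l => jet_kernel Phi s (l, z)).
Proof.
move=> sm Us l l' ll' lm; rewrite /jet_kernel /= (perm_size ll'); congr (_ * _).
apply: (partials_perm oU CPhi) => //; first by rewrite perm_cat2l.
by rewrite size_cat (leq_trans _ mr)// -addnn leq_add.
Qed.

Lemma symmetric_kernell (s : feat) : (size s.1 <= m)%N -> U (z - s.2) ->
  symmetric_jet m (fun l => jet_kernel Phi (l, z) s).
Proof.
move=> sm Us l l' ll' lm; rewrite /jet_kernel /=; congr (_ * _).
apply: (partials_perm oU CPhi) => //; first by rewrite perm_cat2r.
by rewrite size_cat (leq_trans _ mr)// -addnn leq_add.
Qed.

(** Taylor polynomial minus value at the node [X j], in the second argument of the kernel. As a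
    function of [s] it is again a symmetric family at [z], so the same expansion applies in the
    first argument. *)
Let G j (s : feat) : R :=
  taylor_jet z m (jet_kernel Phi s) (X j - z) - jet_kernel Phi s ([::], X j).

Lemma G_symmetric j : symmetric_jet m (fun l => G j (l, z)).
Proof.
move=> l l' ll' lm; rewrite /G; congr (_ - _).
  apply: eq_bigr => c _; congr (_ / _); apply: eq_dirjet => l1.
  rewrite addn0 size_nseq => l1c.
  have l1m : (size l1 <= m)%N by rewrite l1c -ltnS.
  by apply: (symmetric_kernell (s := (l1, z))) => //=; rewrite subrr; exact: BU.
by apply: (symmetric_kernell (s := ([::], X j))) => //=; exact/BU/zXB.
Qed.

Lemma G_remainder i j : taylor_jet z m (G j) (X i - z) - G j ([::], X i) =
  Phi ((X i - z) + (z - X j))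
    - \sum_(e < m.+1) dirjet (nseq e (z - X j)) (jets Phi (X i - z)) [::] / e`!%:R
    - \sum_(c < m.+1) (dirjet (nseq c (X i - z)) (jets Phi (z - X j)) [::]
       - \sum_(e < m.+1) dirjet (nseq c (X i - z) ++ nseq e (z - X j)) (jets Phi 0) [::]
         / e`!%:R) / c`!%:R.
Proof.
have signed l e (x : 'rV[R]_d) : dirjet (nseq e (X j - z))
    (fun l' => jet_kernel Phi (l, x) (l', z)) [::] =
    dirjet (nseq e (z - X j)) (fun l' => partials (l ++ l') Phi (x - z)) [::].
  by rewrite (dirjet_signed _ (fun l' => partials (l ++ l') Phi (x - z))) mul1r map_nseq opprB.
have G1 : G j ([::], X i) =
    \sum_(e < m.+1) dirjet (nseq e (z - X j)) (jets Phi (X i - z)) [::] / e`!%:R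
    - Phi ((X i - z) + (z - X j)).
  rewrite /G; congr (_ - _); last by rewrite /jet_kernel /= mul1r addrA subrK.
  by apply: eq_bigr => e _; rewrite signed.
have G2 c : (c <= m)%N -> dirjet (nseq c (X i - z)) (fun l => G j (l, z)) [::] =
   \sum_(e < m.+1) dirjet (nseq c (X i - z) ++ nseq e (z - X j)) (jets Phi 0) [::] / e`!%:R
   - dirjet (nseq c (X i - z)) (jets Phi (z - X j)) [::].
  move=> cm; rewrite /G -dirjetB; congr (_ - _); last first.
    by apply: eq_dirjet => l _; rewrite /jet_kernel /= mul1r cats0.
  rewrite (dirjet_sum m.+1 _ (fun e l => dirjet (nseq e (X j - z))
    (fun l' => jet_kernel Phi (l, z) (l', z)) [::]) (fun e => e`!%:R)).
  apply: eq_bigr => e _; congr (_ / _).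
  rewrite dirjet_cat; apply: eq_dirjet => l; rewrite size_nseq addn0 => lc.
  rewrite signed subrr -[in RHS](cat0s l) -(dirjet_shift (n := r))//.
    by move=> l1 l2 l12 l1r; apply: (partials_perm oU CPhi) => //; exact: BU.
  rewrite size_nseq addn0 lc (leq_trans _ mr)// -addnn leq_add//.
  by rewrite -ltnS.
rewrite G1 {1}/taylor_jet.
have -> : \sum_(c < m.+1) dirjet (nseq c (X i - z)) (fun l => G j (l, z)) [::] / c`!%:R =
   - \sum_(c < m.+1) (dirjet (nseq c (X i - z)) (jets Phi (z - X j)) [::]
       - \sum_(e < m.+1) dirjet (nseq c (X i - z) ++ nseq e (z - X j)) (jets Phi 0) [::]
         / e`!%:R) / c`!%:R.
  rewrite -sumrN; apply: eq_bigr => c _; rewrite G2; last by rewrite -ltnS.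
  by rewrite -mulNr opprB.
ring.
Qed.

(** Expansion in both arguments leaves the double remainders weighted by [w i * w j]. Their bound is
    a constant times [b i * b j], so the double sum is at most the square of a weighted l1 norm of
    [w]. *)
Lemma error_form_bound q w rho : (m < q)%N -> exact_weight q k a z X w ->
  \sum_j `|w j| * enorm (X j - z) `^ ((r%:R + gamma) / 2) <= rho ->
  lform (jet_kernel Phi) (error_functional k a z X w) (error_functional k a z X w)
    <= C_const d r gamma * H * rho ^+ 2.
Proof.
move=> mq ew wrho; set lam := error_functional k a z X w.
have inner (t : R * feat) : t \in lam ->
    lapp lam (jet_kernel Phi t.2) = \sum_j w j * G j t.2.
  move=> tl; apply: (error_functional_taylor km mq ew).
  suff [tm tU] : (size t.2.1 <= m)%N /\ U (t.2.2 - z) by exact: symmetric_kernelr.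
  have [[tk ->]|[-> [j ->]]] := mem_error_functional tl.
    by rewrite subrr; split; [exact: leq_trans km | exact: BU].
  by split => //; exact/BU/XzB.
have -> : lform (jet_kernel Phi) lam lam =
    \sum_j w j * \sum_i w i * (taylor_jet z m (G j) (X i - z) - G j ([::], X i)).
  rewrite /lform (eq_lapp (v := fun s => \sum_j w j * G j s)) // lapp_fsum.
  apply: eq_bigr => j _; rewrite lapp_fZ; congr (_ * _).
  apply: (error_functional_taylor km mq ew); exact: G_symmetric.
pose b j := enorm (X j - z) `^ ((r%:R + gamma) / 2).
have rem i j : `|taylor_jet z m (G j) (X i - z) - G j ([::], X i)| <=
    C_const d r gamma * H * b i * b j.
  rewrite G_remainder /b -[enorm (X j - z)]enormN opprB.
  apply: (kernel_remainder gamma_gt0 oU CPhi BU H0 PhiH) => t s t01 s01.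
  by have := XB i j t01 s01; rewrite -scalerN opprB.
have CH0 : 0 <= C_const d r gamma * H.
  rewrite mulr_ge0// /C_const; case: ifP => _; rewrite divr_ge0 ?mulr_ge0 ?powR_ge0//;
  rewrite big_seq; apply: prodr_ge0 => v _; exact: sqr_ge0.
have S0 : 0 <= \sum_j `|w j| * b j by apply: sumr_ge0 => j _; rewrite mulr_ge0// powR_ge0.
apply: le_trans (ler_norm _) _.
apply: (@le_trans _ _ (C_const d r gamma * H * (\sum_j `|w j| * b j) ^+ 2)); last first.
  by rewrite ler_wpM2l// lerXn2r// nnegrE// (le_trans S0).
rewrite expr2 mulr_suml mulr_sumr.
apply: le_trans (ler_norm_sum _ _ _) _; apply: ler_sum => j _.
rewrite normrM !mulr_sumr; apply: le_trans (ler_wpM2l (normr_ge0 _) (ler_norm_sum _ _ _)) _.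
rewrite mulr_sumr; apply: ler_sum => i _; rewrite normrM.
apply: le_trans (ler_wpM2l (normr_ge0 _) (ler_wpM2l (normr_ge0 _) (rem i j))) _.
rewrite le_eqVlt; apply/orP; left; apply/eqP.
by move: (b i) (b j) (C_const _ _ _) `|w i| `|w j| => *; ring.
Qed.

End ErrorForm.

(** * Optimality of the kernel weights *)

Section Optimality.
Context {R : realType} {d : nat}.
Notation feat := (seq 'I_d * 'rV[R]_d)%type.
Variables (k s r : nat) (a : multinom d -> 'rV[R]_d -> R) (z : 'rV[R]_d)
  (N : nat) (X : 'I_N -> 'rV[R]_d) (U : set 'rV[R]_d) (Phi : 'rV[R]_d -> R).
Hypotheses (K_sym : symmetric_kernel (ti_kernel Phi))
  (K_cpd : cond_posdef s (ti_kernel Phi)) (oU : open U) (CPhi : Cr_open r Phi U)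
  (UN : forall y, U y -> U (- y)) (kr : (k <= r)%N) (zXU : forall j, U (z - X j)).
Variables (M : nat) (b : 'I_M -> mpoly d R).
Hypothesis b_basis : Pi_basis s b.

Lemma Phi_even y : Phi (- y) = Phi y.
Proof. by have := K_sym 0 y; rewrite /ti_kernel sub0r subr0. Qed.

Lemma exact_weight_basis w :
  (forall i, \sum_(j < N) w j * peval (b i) (X j) = diffop k a (peval (b i)) z) ->
  exact_weight s k a z X w.
Proof.
have [_ bb] := b_basis.
move=> wb p /bb[c [-> _]]; rewrite (linear_form_sum _ _ _ (linear_diffop_peval k a z)).
under eq_bigr do rewrite peval_sum mulr_sumr.
rewrite exchange_big; apply: eq_bigr => i _; rewrite -wb mulr_sumr.
by apply: eq_bigr => j _; rewrite pevalZ mulrCA.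
Qed.

Lemma kernel_weight_optimal w w1 : kernel_weight k a (ti_kernel Phi) b z X w ->
  exact_weight s k a z X w1 ->
  lform (jet_kernel Phi) (error_functional k a z X w) (error_functional k a z X w) <=
  lform (jet_kernel Phi) (error_functional k a z X w1) (error_functional k a z X w1).
Proof.
move=> [v [wK wb]] ew1; have ew := exact_weight_basis wb.
pose eta j := w1 j - w j; pose nu := nodal_part X eta.
set lam := error_functional k a z X w.
have lam1E F : lapp (error_functional k a z X w1) F = lapp (lam ++ lscale (-1) nu) F.
  rewrite [RHS]lapp_cat lapp_scale lapp_nodal_part /lam !lapp_error_functional.
  under [X in _ = _ + _ * X]eq_bigr do rewrite mulrBl.
  by rewrite sumrB; ring.
have eta0 p : Pi_poly s p -> \sum_j eta j * peval p (X j) = 0.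
  move=> ps; under eq_bigr do rewrite mulrBl.
  by rewrite sumrB ew// ew1// subrr.
(* The first group of equations of the kernel system. The right-hand side is a polynomial of
   [Pi_poly s] at the node, which the weight difference [eta] annihilates. *)
have g_poly j : lapp lam (jet_kernel Phi ^~ ([::], X j)) = \sum_(i < M) v i * peval (b i) (X j).
  rewrite lapp_error_functional.
  have /eqP := wK j; rewrite addrC eq_sym -subr_eq => /eqP <-.
  congr (_ - _).
    rewrite diffop_jet; apply: eq_lapp => -[? [l x]] _ /=.
    by rewrite /jet /jet_kernel /= cats0 mul1r /ti_kernel partials_shift.
  by apply: eq_bigr => i _; rewrite /jet_kernel /= mul1r K_sym.
have nu_lam : lform (jet_kernel Phi) lam nu = 0.
  rewrite -[RHS](_ : \sum_j eta j * lapp lam (jet_kernel Phi ^~ ([::], X j)) = 0).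
    under [RHS]eq_bigr do rewrite -lapp_fZ; rewrite -lapp_fsum.
    by apply: eq_lapp => t _; rewrite lapp_nodal_part.
  under eq_bigr do rewrite g_poly mulr_sumr; rewrite exchange_big.
  rewrite big1// => i _; under eq_bigr do rewrite mulrCA.
  by rewrite -mulr_sumr eta0 ?mulr0//; exact: b_basis.1.
have lam_nu : lform (jet_kernel Phi) nu lam = lform (jet_kernel Phi) lam nu.
  transitivity (lapp lam (fun t => lapp nu (jet_kernel Phi ^~ t))).
    exact: (lappC nu lam (jet_kernel Phi)).
  apply: eq_lapp => t tl.
  apply: eq_lapp => u /mapP[j _ ->] /=.
  have [[tk tz]|[t0 [i ti]]] := mem_error_functional tl.
    (* Exchanging the arguments gives the sign [(-1) ^+ size t.2.1] twice, from [jet_kernel] and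
       from evenness of [Phi], and the two cancel. *)
    have ev := @partials_even R d r U Phi oU CPhi t.2.1 (z - X j) UN Phi_even
      (leq_trans tk kr) (zXU j).
    by rewrite /jet_kernel /= cats0 mul1r tz -opprB ev mulrA -expr2 sqrr_sign mul1r.
  by rewrite /jet_kernel /= t0 ti /= !mul1r; exact: K_sym.
have nu0 : 0 <= lform (jet_kernel Phi) nu nu.
  pose nu' := [seq (eta j, X j) | j : 'I_N].
  have nuE (F : feat -> R) : lapp nu F = lapp nu' (fun x => F ([::], x)).
    by rewrite /lapp !big_image.
  have -> : lform (jet_kernel Phi) nu nu = lform (ti_kernel Phi) nu' nu'.
    rewrite /lform nuE; apply: eq_lapp => t _; rewrite nuE.
    by apply: eq_lapp => u _; rewrite /jet_kernel /= mul1r.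
  by apply: (lform_ge0 K_cpd) => p ps; rewrite big_image/=; exact: eta0.
have -> : lform (jet_kernel Phi) (error_functional k a z X w1) (error_functional k a z X w1) =
    lform (jet_kernel Phi) (lam ++ lscale (-1) nu) (lam ++ lscale (-1) nu).
  by rewrite {1}/lform lam1E; apply: eq_lapp => t _; exact: lam1E.
rewrite [leRHS]lform_comb lam_nu nu_lam sqrrN expr1n mul1r addr0 mulr0 addr0.
by rewrite lerDl.
Qed.

End Optimality.

(** * Hoelder semi-norm along lists of indices *)

Section HolderSeminorm.
Context {R : realType} {d : nat}.
Implicit Types (x y : 'rV[R]_d).

Lemma holder_seminorm_ge0 r gamma A (f : 'rV[R]_d -> R) :
  (0 <= holder_seminorm r gamma A f)%E.
Proof.
rewrite /holder_seminorm; elim/big_ind: _ => // [u v u0 v0|alpha _].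
  by rewrite le_max u0.
by rewrite /holder0_seminorm le_max lexx.
Qed.

Lemma enorm_eq0 x : (enorm x == 0) = (x == 0).
Proof.
apply/idP/idP => [|/eqP ->]; last first.
  by rewrite -(scale0r 0) enormZ normr0 mul0r.
rewrite sqrtr_eq0 => S0; apply/eqP/rowP => i; rewrite mxE; apply/eqP.
rewrite -sqrf_eq0 eq_le sqr_ge0 andbT (le_trans _ S0)//.
by rewrite (bigD1 i)//= lerDl; apply: sumr_ge0 => j _; exact: sqr_ge0.
Qed.

Lemma holder_seminorm_bound r gamma (U B : set 'rV[R]_d) f l x y :
  open U -> Cr_open r f U -> B `<=` U ->
  (holder_seminorm r gamma B f < +oo)%E -> size l = r -> B x -> B y ->
  `|partials l f x - partials l f y| <=
    fine (holder_seminorm r gamma B f) * enorm (x - y) `^ gamma.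
Proof.
move=> oU Cf BU fin lr Bx By.
set H := fine _.
have H0 : 0 <= H by apply: fine_ge0; exact: holder_seminorm_ge0.
have [->|xy] := eqVneq x y; first by rewrite subrr normr0 mulr_ge0// powR_ge0.
have exy : 0 < enorm (x - y) by rewrite lt_def enorm_ge0 enorm_eq0 subr_eq0 xy.
rewrite -ler_pdivrMr ?powR_gt0//.
pose alpha := Multinom [tuple count_mem i l | i < d].
have pl : perm_eq (mlist alpha) l := perm_mlist l.
have mr : mdeg alpha = r by rewrite -size_mlist (perm_size pl).
have mr' : (mdeg alpha < r.+1)%N by rewrite mr.
have aE u : B u -> partials l f u = mpartial alpha f u.
  move=> Bu; apply/esym/(partials_perm oU Cf pl); last exact: BU.
  by rewrite size_mlist mr.
rewrite !aE// -lee_fin /H fineK ?ge0_fin_numE ?holder_seminorm_ge0//.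
rewrite /holder_seminorm (bigD1 (BMultinom mr'))/= ?mr//.
rewrite le_max; apply/orP; left; rewrite /holder0_seminorm le_max; apply/orP; right.
by apply: ereal_sup_ubound; exists x, y.
Qed.

End HolderSeminorm.

(** * Segments, the ball and a neighbourhood of the centre *)

Section Geometry.
Context {R : realType} {d : nat}.
Implicit Types (x y z : 'rV[R]_d).

Lemma enorm_le_l1norm x : enorm x <= l1norm x.
Proof.
rewrite -(ger0_norm (l1norm_ge0 x)) -sqrtr_sqr ler_wsqrtr// expr2 {1}/l1norm mulr_suml.
apply: ler_sum => i _; rewrite -real_normK ?num_real// expr2 ler_wpM2l//.
by rewrite /l1norm (bigD1 i)//= lerDl sumr_ge0.
Qed.

Lemma l1normB x y : l1norm (x - y) <= l1norm x + l1norm y.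
Proof. by rewrite -big_split; apply: ler_sum => i _; rewrite !mxE ler_normB. Qed.

Lemma l1normZ (t : R) x : l1norm (t *: x) = `|t| * l1norm x.
Proof. by rewrite mulr_sumr; apply: eq_bigr => i _; rewrite mxE normrM. Qed.

Variables (z : 'rV[R]_d) (N : nat) (X : 'I_N -> 'rV[R]_d).

Lemma segment_unionP i (t : R) : 0 <= t <= 1 ->
  segment_union z X (z + t *: (X i - z)).
Proof.
move=> t01; exists i, t; split => //.
by apply/rowP => j; rewrite !mxE; ring.
Qed.

(** This makes the [sup] in [diameter] an actual upper bound. The l1 norm is used because its
    triangle inequality is coordinatewise. *)
Lemma has_ubound_distances :
  has_ubound [set enorm (x - y) | x in segment_union z X & y in segment_union z X].
Proof.
pose S := \sum_i l1norm (X i - z).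
exists (S + S) => _ [_ [i [t [t01 ->]]] [_ [j [u [u01 ->]]] <-]].
have bd i' (v : R) : 0 <= v <= 1 -> l1norm (v *: (X i' - z)) <= S.
  move=> /andP[v0 v1]; rewrite l1normZ ger0_norm//.
  apply: (@le_trans _ _ (l1norm (X i' - z))); first by rewrite ler_piMl ?l1norm_ge0.
  by rewrite /S (bigD1 i')//= lerDl sumr_ge0// => k _; exact: l1norm_ge0.
have -> : (1 - t) *: z + t *: X i - ((1 - u) *: z + u *: X j) =
    t *: (X i - z) - u *: (X j - z).
  by apply/rowP => k; rewrite !mxE; ring.
by rewrite (le_trans (enorm_le_l1norm _))// (le_trans (l1normB _ _))// lerD ?bd.
Qed.

Lemma ballzX_diff i j (t s : R) : 0 <= t <= 1 -> 0 <= s <= 1 ->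
  ballzX z X (t *: (X i - z) - s *: (X j - z)).
Proof.
move=> t01 s01; apply: ub_le_sup; first exact: has_ubound_distances.
exists (z + t *: (X i - z)); first exact: segment_unionP.
exists (z + s *: (X j - z)); first exact: segment_unionP.
by rewrite opprD addrACA subrr add0r.
Qed.

Lemma ballzX0 : ballzX z X 0.
Proof.
rewrite /ballzX /= -(scale0r 0) enormZ normr0 mul0r /diameter.
set D := [set _ | _ in _ & _ in _].
(* Without nodes there are no distances; [sup] is then 0 by default and the ball is the point 0. *)
have [->|/set0P[_ [x Sx [y Sy _]]]] := eqVneq D set0; first by rewrite sup0.
apply: le_trans (enorm_ge0 (x - y)) _; apply: ub_le_sup; first exact: has_ubound_distances.
by exists x => //; exists y.
Qed.

Lemma ballzXN x : ballzX z X x -> ballzX z X (- x).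
Proof. by rewrite /ballzX /= enormN. Qed.

(** For [W] a small ball around [z], differences within [W] stay near 0, and differences with [X j]
    stay near [z - X j]; all these centres lie in the open set [U]. *)
Lemma good_neighbourhood (U : set 'rV[R]_d) : open U -> (forall x, U x -> U (- x)) ->
  U 0 -> (forall j, U (z - X j)) ->
  exists W : set 'rV[R]_d, [/\ open W, W z &
    forall x y, W x -> (W y \/ exists j, y = X j) -> U (x - y) /\ U (y - x)].
Proof.
move=> oU UN U0 UX.
have /nbhs_ballP[e /= e0 eU] : nbhs (0 : 'rV[R]_d) U by exact: open_nbhs_nbhs.
have /nbhs_ballP[e' /= e'0 e'U] : \forall x \near z, forall j, U (x - X j).
  apply: (@filter_forall _ 'I_N (fun j x => U (x - X j)) (nbhs z) (nbhs_filter z)) => j.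
  have /nbhs_ballP[e' /= e'0 e'U] : nbhs (z - X j) U by exact: open_nbhs_nbhs.
  apply/nbhs_ballP; exists e' => //= x; rewrite -ball_normE /= => xz.
  by apply: e'U; rewrite -ball_normE /= opprB addrA subrK.
pose del := Num.min (e / 2) e'.
exists (ball z del); split.
- by apply: ball_open; rewrite lt_min divr_gt0.
- by apply: ballxx; rewrite lt_min divr_gt0.
move=> x y; rewrite -ball_normE /= lt_min => /andP[xe xe'].
suff : (`|z - y| < del \/ exists j, y = X j) -> U (x - y).
  by move=> H /H Uxy; split => //; rewrite -opprB; exact: UN.
case=> [|[j ->]]; last by apply: e'U; rewrite -ball_normE.
rewrite lt_min => /andP[ye _]; apply: eU; rewrite -ball_normE /= sub0r opprB.
rewrite -(subrKA z) (le_lt_trans (ler_normD _ _))// [ltRHS]splitr distrC.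
by rewrite addrC ltrD// distrC.
Qed.

End Geometry.

Theorem corollary2 (R : realType) (d : nat) (d_gt0 : (0 < d)%N)
    (k : nat) (a : multinom d -> 'rV[R]_d -> R)
    (s : nat) (Phi : 'rV[R]_d -> R)
    (K_sym : symmetric_kernel (ti_kernel Phi))
    (K_cpd : cond_posdef s (ti_kernel Phi))
    (z : 'rV[R]_d) (N : nat) (X : 'I_N -> 'rV[R]_d) (X_inj : injective X)
    (ex_exact : exists w : 'I_N -> R, exact_weight s k a z X w)
    (r : nat) (gamma : R) (r_ge2k : (2 * k <= r)%N)
    (gamma_gt0 : 0 < gamma) (gamma_le1 : gamma <= 1)
    (Phi_holder : in_holder r gamma (ballzX z X) Phi)
    (M : nat) (b : 'I_M -> mpoly d R) (b_basis : Pi_basis s b)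
    (w : 'I_N -> R) (w_kernel : kernel_weight k a (ti_kernel Phi) b z X w) :
  let q := maxn s (r./2).+1 in
  let rho := growth q k a z X ((r%:R + gamma) / 2) in
  forall f : 'rV[R]_d -> R, native_space (ti_kernel Phi) s f ->
    (* Df(z) is well defined *)
    Cr_on k f [set z] /\
    (* the bound is void if rho is infinite *)
    ((rho < +oo)%E ->
     `|diffop k a f z - \sum_(j < N) w j * f (X j)|
       <= fine rho * Num.sqrt (C_const d r gamma)
          * Num.sqrt (fine (holder_seminorm r gamma (ballzX z X) Phi))
          * native_norm (ti_kernel Phi) s f).
Proof.
move=> q rho f native_f.
have [[U0 [oU0 BU0 CU0]] fin] := Phi_holder.
set B := ballzX z X in BU0 fin *; set H := fine (holder_seminorm r gamma B Phi).
(* The symmetrized set still contains the ball, and on it evenness of [Phi] passes to the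
   derivatives. *)
pose U := U0 `&` [set y | U0 (- y)].
have oU : open U.
  apply: openI => //; apply: (open_comp _ oU0) => y _.
  by apply: continuousN; exact: cvg_id.
have BU : B `<=` U by move=> y By; split; [exact: BU0 | apply: BU0; exact: ballzXN].
have UN y : U y -> U (- y) by case=> Uy UNy; split; rewrite //= opprK.
have CU : Cr_open r Phi U by apply: Cr_openS CU0 => y [].
have H0 : 0 <= H by apply: fine_ge0; exact: holder_seminorm_ge0.
have PhiH l x y := @holder_seminorm_bound R d r gamma U B Phi l x y oU CU BU fin.
have XB : forall i j (t u : R), 0 <= t <= 1 -> 0 <= u <= 1 ->
    B (t *: (X i - z) - u *: (X j - z)) by move=> *; exact: ballzX_diff.
have B0 : B 0 by exact: ballzX0.
have zXU j : U (z - X j).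
  apply: BU; have := XB j j 0 1; rewrite scale0r scale1r sub0r opprB.
  by apply; rewrite !(lexx, ler01).
have [W [oW Wz WU]] := good_neighbourhood oU UN (BU _ B0) zXU.
pose Y := W `|` [set y | exists j, y = X j].
have WY : W `<=` Y by move=> y Wy; left.
have [E [EY Es Erep]] := reproducing_points Y b_basis.
(* [get] chooses some limit of semi-norms; the argument holds for whichever value is chosen. *)
have native_c : is_native_norm (ti_kernel Phi) s f (native_norm (ti_kernel Phi) s f).
  by have [c0 fc0] := native_f; apply: (@getPex _ [set c | is_native_norm _ s f c]); exists c0.
set c := native_norm _ s f in native_c *.
have c0 := native_norm_ge0 native_c.
have fbound mu amu := @native_bound R d s _ K_sym K_cpd f c mu native_c amu.
have Cf : Cr_open k f W.
  exact: (Cr_open_native oU oW CU WY WU r_ge2k fbound EY Erep).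
split; first by exists W; split => // _ ->.
move=> rho_fin.
have rho_ub p : Pi_poly q p ->
    (forall j, `|peval p (X j)| <= enorm (X j - z) `^ ((r%:R + gamma) / 2)) ->
    ((diffop k a (peval p) z)%:E <= rho)%E.
  by move=> pq pX; apply: ereal_sup_ubound; exists p.
have rho_ge0 : (0 <= rho)%E.
  have <- : (diffop k a (peval 0) z)%:E = 0%E.
    by rewrite (linear_form0 (linear_diffop_peval k a z)).
  apply: rho_ub => [|j]; first exact: Pi_poly0.
  by rewrite /peval meval0 normr0 powR_ge0.
have rho0 : 0 <= fine rho by exact: fine_ge0.
have rho_ge p : Pi_poly q p ->
    (forall j, `|peval p (X j)| <= enorm (X j - z) `^ ((r%:R + gamma) / 2)) ->
    diffop k a (peval p) z <= fine rho.
  by move=> pq pX; rewrite -lee_fin fineK ?ge0_fin_numE//; exact: rho_ub.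
have [w1 w1E w1rho] := @l1_duality R (mpoly d R) (Pi_poly q) (Pi_poly0 q)
  (fun t x y Sx Sy => Pi_polyD (Pi_polyZ t Sx) Sy) N
  (fun p => diffop k a (peval p) z) (fun j p => peval p (X j))
  (fun j => enorm (X j - z) `^ ((r%:R + gamma) / 2)) (fine rho)
  (linear_diffop_peval k a z) (fun j t x y => etrans (pevalD _ _ _) (congr1 (+%R^~ _) (pevalZ _ _ _)))
  (fun j => powR_ge0 _ _) rho_ge.
have ew1 : exact_weight q k a z X w1 by move=> p ps; rewrite w1E.
(* This is why [q] is at least [s]: the dual weights compete with the kernel weights. That [q]
   exceeds [r./2] serves the Taylor expansion. *)
have ew1s : exact_weight s k a z X w1.
  by move=> p ps; apply: ew1; apply: leq_trans ps _; rewrite leq_maxl.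
have kr : (k <= r)%N by apply: leq_trans r_ge2k; rewrite leq_pmull.
have opt := kernel_weight_optimal K_sym K_cpd oU CU UN kr zXU b_basis w_kernel ew1s.
have bound := error_form_bound gamma_gt0 oU CU BU H0 PhiH r_ge2k XB B0
  (leq_maxr s (r./2).+1) ew1 w1rho.
have ew : exact_weight s k a z X w.
  by have [v [_ wb]] := w_kernel; exact: exact_weight_basis wb.
have jetb := native_jet_bound oU oW CU WY WU r_ge2k fbound EY Es Erep
  (l := error_functional k a z X w).
have : (diffop k a f z - \sum_(j < N) w j * f (X j)) ^+ 2 <=
    c ^+ 2 * (C_const d r gamma * H * fine rho ^+ 2).
  have -> : diffop k a f z - \sum_(j < N) w j * f (X j) =
      lapp (error_functional k a z X w) (jet f).
    by rewrite lapp_error_functional -diffop_jet.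
  apply: le_trans (jetb _ _) _.
  - move=> t /mem_error_functional[[tk tz]|[t0 [j tj]]].
      by left; rewrite tz.
    by right; split => //; right; exists j.
  - by move=> p ps; exact: error_functional_pjet ew ps.
  - by rewrite ler_wpM2l ?sqr_ge0// (le_trans opt).
move=> sq.
have C0 : 0 <= C_const d r gamma.
  rewrite /C_const; case: ifP => _; rewrite divr_ge0 ?mulr_ge0 ?powR_ge0//;
  by rewrite big_seq; apply: prodr_ge0 => v _; exact: sqr_ge0.
rewrite -(ler_pXn2r (n := 2)) ?nnegrE ?mulr_ge0 ?sqrtr_ge0//.
rewrite real_normK ?num_real// (le_trans sq)//.
rewrite !exprMn !sqr_sqrtr//.
by rewrite le_eqVlt; apply/orP; left; apply/eqP; ring.
Qed.
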